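(* Consider the radial compressible Euler equations in $n>1$ dimensions with equation of state $p=p(\rho,S)$, and let $J$ be a function of $t,r$, the fluid variables $U,\rho,S$, and their $r$-derivatives. The following conditions are equivalent: (i) $J$ is a scalar invariant; (ii) $r^{n-1}\rho J\,\mathbf{d}r$ is a 1-form invariant; (iii) $\dfrac{r^{1-n}}{\rho J}\,\hat r$ is a vector invariant; (iv) $\int_{V(t)}\rho J\,r^{n-1}dr\,\big|_{\mathcal E}$ is an integral invariant for all transported radial domains $V(t)$.
   Context: Radial Euler equations: for functions $U(r,t)$ (radial velocity), $\rho(r,t)$ (density), $S(r,t)$ (entropy), with $r=|\vec{x}|$ the radial coordinate in $\mathbb{R}^n$ and $\hat r$ the radial unit vector, $$U_t+UU_r+(p_S S_r+p_\rho\rho_r)/\rho=0,\quad \rho_t+(U\rho)_r+\tfrac{n-1}{r}U\rho=0,\quad S_t+US_r=0,$$ with equation of state $p=p(\rho,S)$. $D_t$, $D_r$ denote total derivatives, acting by the chain rule on the fluid variables and their derivatives, and $|_{\mathcal E}$ means evaluation on the solution space (all $t$-derivatives eliminated by means of the Euler equations). For a function $J$ of $t,r$, the fluid variables and their $r$-derivatives: - $J$ is a scalar invariant if $(D_tJ+U D_rJ)|_{\mathcal E}=0$; - the radial 1-form $J\,\mathbf{d}r$ is a 1-form invariant if $(D_tJ+D_r(UJ))|_{\mathcal E}=0$; - the radial vector $J\hat r$ is a vector invariant if $(D_tJ+U D_rJ-J D_rU)|_{\mathcal E}=0$. A transported radial domain $V(t)$ is a radial domain that is transported by the flow, i.e.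 its endpoints $r_i(t)$ satisfy $dr_i/dt=U(r_i(t),t)$. An integral $\int_{V(t)}\Phi^t\,r^{n-1}dr\big|_{\mathcal E}$ is an integral invariant if $\frac{d}{dt}\int_{V(t)}\Phi^t\,r^{n-1}dr\big|_{\mathcal E}=0$. *)

(* Defs.v *)
From HB Require Import structures.
From mathcomp Require Import all_boot all_order all_algebra.
From mathcomp Require Import all_classical all_reals all_analysis.
Import Order.TTheory GRing.Theory Num.Theory.
Import numFieldNormedType.Exports.

Set Implicit Arguments.
Unset Strict Implicit.
Unset Printing Implicit Defensive.

Local Open Scope classical_set_scope.
Local Open Scope ring_scope.

(* C^oo on A: all iterated directional derivatives are Frechet differentiable
   at each point of A.  Meaningful for open A. *)
Definition smooth_on (R : realType) (V : normedModType R) (A : set V)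
    (f : V -> R) : Prop :=
  forall (vs : seq V) (x : V), A x ->
    differentiable (foldr (fun v (g : V -> R) => 'D_v g) f vs) x.

Definition iU : 'I_3 := @Ordinal 3 0 isT.
Definition irho : 'I_3 := @Ordinal 3 1 isT.
Definition iS : 'I_3 := @Ordinal 3 2 isT.

(* Points (t, r, v) of the jet space of order k; v a i stands for the i-th
   r-derivative of the fluid variable a.  There are no coordinates for
   t-derivatives: they are always eliminated through the Euler equations. *)
Notation jet R k := (R * R * 'M[R]_(3, k.+1))%type.

Section JetSpace.
Variable R : realType.

Definition jrad k (x : jet R k) : R := x.1.2.

(* [i] is meant to be at most the order k of the jet. *)
Definition jcoord k (a : 'I_3) (i : nat) (x : jet R k) : R := x.2 a (inord i).

Definition jvel k (x : jet R k) : R := jcoord iU 0 x.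
Definition jdens k (x : jet R k) : R := jcoord irho 0 x.
Definition jentr k (x : jet R k) : R := jcoord iS 0 x.

(* The projection onto lower order jets; only used for l <= k. *)
Definition trunc k l (x : jet R k) : jet R l :=
  (x.1, \matrix_(a, i) jcoord a i x).

Definition part_t k (J : jet R k -> R) : jet R k -> R :=
  'D_((1, 0, 0) : jet R k) J.
Definition part_r k (J : jet R k -> R) : jet R k -> R :=
  'D_((0, 1, 0) : jet R k) J.
Definition part_v k (a : 'I_3) (i : 'I_k.+1) (J : jet R k -> R) :
    jet R k -> R :=
  'D_((0, 0, delta_mx a i) : jet R k) J.

(* The total derivative D_r. *)
Definition Dr k (J : jet R k -> R) (y : jet R k.+1) : R :=
  part_r J (trunc k y)
  + \sum_(a < 3) \sum_(i < k.+1) part_v a i J (trunc k y) * jcoord a i.+1 y.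

Fixpoint Dr_iter (i : nat) k (F : jet R k -> R) : jet R (i + k) -> R :=
  match i return jet R (i + k) -> R with
  | 0 => F
  | i'.+1 => Dr (@Dr_iter i' k F)
  end.

(* The right-hand sides of the Euler equations solved for U_t, rho_t, S_t. *)
Definition euler_rhs (n : nat) (p : R * R -> R) (a : 'I_3) (x : jet R 1) : R :=
  let q := (jdens x, jentr x) in
  if a == iU then
    - (jvel x * jcoord iU 1 x
       + ('D_((0, 1) : R * R) p q * jcoord iS 1 x
          + 'D_((1, 0) : R * R) p q * jcoord irho 1 x) / jdens x)
  else if a == irho then
    - (Dr (fun z : jet R 0 => jvel z * jdens z) x
       + (n.-1)%:R / jrad x * (jvel x * jdens x))
  else - (jvel x * jcoord iS 1 x).

(* D_t J evaluated on the solution space: in the chain rule, the t-derivative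
   of the i-th r-derivative of a fluid variable is replaced by D_r^i of the
   corresponding right-hand side. *)
Definition DtE (n : nat) (p : R * R -> R) k (J : jet R k -> R)
    (y : jet R k.+1) : R :=
  part_t J (trunc k y)
  + \sum_(a < 3) \sum_(i < k.+1)
      part_v a i J (trunc k y)
      * @Dr_iter i 1 (euler_rhs n p a) (trunc (i + 1) y).

(* [u a t r] is the value at (t, r) of the fluid variable a. *)
Definition jet_of k (u : 'I_3 -> R -> R -> R) (t r : R) : jet R k :=
  (t, r, \matrix_(a, i) (derive1n i (u a t) r)).

Definition euler_eqs (n : nat) (p : R * R -> R) (u : 'I_3 -> R -> R -> R)
    (t r : R) : Prop :=
  let U := u iU in let rho := u irho in let S := u iS in
  let q := (rho t r, S t r) in
  [/\ derive1 (U ^~ r) t + U t r * derive1 (U t) r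
        + ('D_((0, 1) : R * R) p q * derive1 (S t) r
           + 'D_((1, 0) : R * R) p q * derive1 (rho t) r) / rho t r = 0,
      derive1 (rho ^~ r) t + derive1 (U t \* rho t) r
        + (n.-1)%:R / r * (U t r * rho t r) = 0
    & derive1 (S ^~ r) t + U t r * derive1 (S t) r = 0].

(* Smooth solution on an open region W of points (t, r) away from the origin
   and from vacuum, with (rho, S) in the domain P of the equation of state. *)
Definition euler_solution (n : nat) (p : R * R -> R) (P : set (R * R))
    (u : 'I_3 -> R -> R -> R) (W : set (R * R)) : Prop :=
  [/\ open W,
      forall a, smooth_on W (fun z : R * R => u a z.1 z.2),
      forall t r, W (t, r) ->
        [/\ 0 < r, 0 < u irho t r & P (u irho t r, u iS t r)]
    & forall t r, W (t, r) -> euler_eqs n p u t r].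

(* G vanishes along every solution, where the latter has its k-jet in the
   domain Om of the differential function under consideration. *)
Definition vanishes_on_solutions (n : nat) (p : R * R -> R) (P : set (R * R))
    k (Om : set (jet R k)) (G : jet R k.+1 -> R) : Prop :=
  forall (u : 'I_3 -> R -> R -> R) (W : set (R * R)),
    euler_solution n p P u W ->
    forall t r, W (t, r) -> Om (jet_of k u t r) -> G (jet_of k.+1 u t r) = 0.

Definition scalar_invariant n p P k (Om : set (jet R k)) (J : jet R k -> R) :=
  vanishes_on_solutions n p P Om (fun y => DtE n p J y + jvel y * Dr J y).

Definition one_form_invariant n p P k (Om : set (jet R k))
    (J : jet R k -> R) :=
  vanishes_on_solutions n p P Om
    (fun y => DtE n p J y + Dr (fun x => jvel x * J x) y).

Definition vector_invariant n p P k (Om : set (jet R k)) (J : jet R k -> R) :=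
  vanishes_on_solutions n p P Om
    (fun y => DtE n p J y + jvel y * Dr J y
              - J (trunc k y) * Dr (@jvel k) y).

(* The radial domains V(t) = [r1 t, r2 t], for t in the open interval ]t1, t2[,
   are transported by the flow U. *)
Definition transported (U : R -> R -> R) (t1 t2 : R) (r1 r2 : R -> R) : Prop :=
  forall t, t1 < t < t2 ->
    [/\ r1 t < r2 t, is_derive t (1 : R) r1 (U t (r1 t))
      & is_derive t (1 : R) r2 (U t (r2 t))].

Definition integral_invariant n p P k (Om : set (jet R k))
    (Phi : jet R k -> R) : Prop :=
  forall (u : 'I_3 -> R -> R -> R) (W : set (R * R)),
    euler_solution n p P u W ->
    forall (t1 t2 : R) (r1 r2 : R -> R),
      transported (u iU) t1 t2 r1 r2 ->
      (forall t r, t1 < t < t2 -> r1 t <= r <= r2 t ->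
         W (t, r) /\ Om (jet_of k u t r)) ->
      forall t, t1 < t < t2 ->
        is_derive t (1 : R)
          (fun s => \int[lebesgue_measure]_(r in `[r1 s, r2 s])
                      (Phi (jet_of k u s r) * r ^+ n.-1)) 0.

End JetSpace.

(* Main.v *)
(* Along a solution, [DtE] and [Dr] become the partial derivatives of the
   function f(t, r) obtained by evaluating J on the jet of the solution (chain
   rule, Schwarz and the differentiated Euler equations).  The mass density
   m = r^(n-1) rho satisfies m_t + (U m)_r = 0, whence
     (m f)_t + (U m f)_r = m (f_t + U f_r),
   and the defect of 1 / (m f) as a vector invariant is the left-hand side
   divided by -(m f)^2.  Conversely the vector condition controls only the
   points where f is not 0, and continuity of f_t + U f_r fills the gap.

   For the integrals, the transport theorem gives
     d/dt int_{V(t)} m f dr = int_{V(t)} m (f_t + U f_r) dr,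
   so that it remains to have enough transported domains to localize.  The
   particle paths are found without solving an ODE: m_t + (U m)_r = 0 provides
   a stream function N with N_r = m > 0 and N_t = - U m, and its level curves
   satisfy r' = U. *)
Require Import Defs.
From HB Require Import structures.
From mathcomp Require Import all_boot all_order all_algebra.
From mathcomp Require Import all_classical all_reals all_analysis.
From mathcomp Require Import ring lra.
Import Order.TTheory GRing.Theory Num.Theory.
Import numFieldNormedType.Exports.
Set Implicit Arguments.
Unset Strict Implicit.
Unset Printing Implicit Defensive.

Local Open Scope classical_set_scope.
Local Open Scope ring_scope.

(** * Smooth functions *)

(** All conditions quantify over solutions, so they are pulled back from jets to functions on an
    open set of the (t, r) plane. There the i-th [Dr] of a right-hand side, by which [DtE]
    eliminates time derivatives, has to be recognized as the time derivative of the i-th radial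
    derivative. This costs smoothness of every iterate on jet space and the symmetry of second
    derivatives. The endpoints of a transported domain and the level curves enter through their
    derivative at a single time. Instead of a joint chain rule for N(s, r(s)), slope functions in
    the sense of Caratheodory are used: the increment is split into one in s at a fixed place and
    one in x at the moving time s, and the mean value theorem controls the latter. The level curves
    come from the intermediate value theorem and choice; strict monotonicity in x makes them
    continuous. They exist only for short times, which suffices for localizing near one point. *)

Section Differentiability.
Variables (R : realType) (V W : normedModType R).

(** Smoothness on an open set depends only on the values there; this allows a formula for a
    derivative, valid on the set alone, to be differentiated again. *)
Lemma near_eq_differentiable (f g : V -> W) (x : V) :
  (\forall y \near x, f y = g y) -> differentiable f x -> differentiable g x.
Proof.
move=> fg df; have [dfc dfo] := (diff_locallyP x f).1 df.
have go : g \o shift x = cst (g x) + 'd f x +o_ 0 id.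
  apply/eqaddoP => e e0; move/eqaddoP : dfo => /(_ e e0).
  have fg0 : \forall h \near (0 : V), f (h + x) = g (h + x).
    by move: fg; rewrite (near_shift 0) subr0.
  apply: filter_app; near=> h.
  rewrite /cst /= !fctE /= (nbhs_singleton fg).
  by have -> : f (h + x) = g (h + x) by near: h.
have E := diff_unique dfc go.
by apply/diff_locallyP; rewrite E.
Unshelve. all: by end_near. Qed.

Lemma linear_diff_derive (f : V -> W) : linear f -> continuous f ->
  forall x, differentiable f x /\ forall v, 'D_v f x = f v.
Proof.
move=> flin cf x; pose fM := GRing.isLinear.Build _ _ _ _ _ flin.
pose fL : {linear _ -> _} := HB.pack f fM.
have df : differentiable f x by apply: (@linear_differentiable _ _ _ fL).
by split=> // v; rewrite deriveE // (@diff_lin _ _ _ fL).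
Qed.

Lemma differentiable_sum_fun (I : Type) (r : seq I) (F : I -> V -> W) x :
  (forall i, differentiable (F i) x) ->
  differentiable (fun z => \sum_(i <- r) F i z) x.
Proof.
move=> dF; elim: r => [|i r IH].
  by rewrite (_ : (fun _ => _) = cst 0)//; apply/funext => z; rewrite big_nil.
rewrite (_ : (fun _ => _) = F i + (fun z => \sum_(i <- r) F i z)).
  exact: differentiableD.
by apply/funext => z; rewrite big_cons.
Qed.

Lemma derive_sum_fun (I : Type) (r : seq I) (F : I -> V -> W) x v :
  (forall i, differentiable (F i) x) ->
  'D_v (fun z => \sum_(i <- r) F i z) x = \sum_(i <- r) 'D_v (F i) x.
Proof.
move=> dF; elim: r => [|i r IH].
  rewrite (_ : (fun _ => _) = cst 0) ?derive_cst ?big_nil//.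
  by apply/funext => z; rewrite big_nil.
rewrite (_ : (fun _ => _) = F i + (fun z => \sum_(i <- r) F i z)).
  rewrite deriveD ?big_cons ?IH//; apply: diff_derivable => //.
  exact: differentiable_sum_fun.
by apply/funext => z; rewrite big_cons.
Qed.

Lemma derive_comp (U : normedModType R) (f : V -> W) (g : W -> U) x v :
  differentiable f x -> differentiable g (f x) ->
  'D_v (fun z => g (f z)) x = 'D_('D_v f x) g (f x).
Proof.
move=> df dg; rewrite !deriveE//; last exact: (@differentiable_comp _ _ _ _ f g).
by rewrite (diff_comp df dg).
Qed.

End Differentiability.

Lemma derive_sumr (R : realType) (V W : normedModType R) (I : Type) (r : seq I)
  (g : V -> W) x (c : I -> R) (e : I -> V) : differentiable g x ->
  'D_(\sum_(i <- r) c i *: e i) g x = \sum_(i <- r) c i *: 'D_(e i) g x.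
Proof.
move=> dg; rewrite deriveE// linear_sum; apply: eq_bigr => i _.
by rewrite linearZ deriveE.
Qed.

Section Coordinates.
Variables (R : realType) (V W : normedModType R) (I : finType).
Variables (Phi : V -> W) (phi : I -> V -> R) (e : I -> W).
Hypothesis PhiE : forall z, Phi z = \sum_i phi i z *: e i.

Lemma differentiable_coords x :
  (forall i, differentiable (phi i) x) -> differentiable Phi x.
Proof.
move=> dphi; rewrite (_ : Phi = fun z => \sum_i phi i z *: e i); last first.
  exact/funext.
by apply: differentiable_sum_fun => i; exact: differentiableZl.
Qed.

(** [smooth_on] speaks of scalar functions, so a map into a jet space or into the plane is given as
    a finite combination of fixed vectors with scalar coefficients, and the chain rule becomes a
    finite sum. *)
Lemma derive_comp_coords (J : W -> R) x v :
  (forall i, differentiable (phi i) x) -> differentiable J (Phi x) ->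
  'D_v (fun z => J (Phi z)) x
  = \sum_i 'D_(e i) J (Phi x) * 'D_v (phi i) x.
Proof.
move=> dphi dJ; rewrite derive_comp//; last exact: differentiable_coords.
have -> : 'D_v Phi x = \sum_i 'D_v (phi i) x *: e i.
  rewrite [in LHS](_ : Phi = fun z => \sum_i phi i z *: e i); last exact/funext.
  rewrite derive_sum_fun; last by move=> i; exact: differentiableZl.
  apply: eq_bigr => i _; rewrite deriveE; last exact: differentiableZl.
  by rewrite diffZl// deriveE.
rewrite derive_sumr//; apply: eq_bigr => i _.
by rewrite mulrC.
Qed.

End Coordinates.

(** * Closure properties of smooth functions *)

Section FiniteSmoothness.
Variable R : realType.
Implicit Types V W : normedModType R.

(* [smooth_on] truncated at order [m], so that closure properties can be proved
   by induction on the order. *)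
Fixpoint diffn_on V (m : nat) (A : set V) (f : V -> R) : Prop :=
  if m is m'.+1 then
    (forall x, A x -> differentiable f x)
    /\ forall v, diffn_on m' A ('D_v f)
  else True.

Lemma smooth_onP V (A : set V) (f : V -> R) :
  smooth_on A f <-> forall m, diffn_on m A f.
Proof.
split=> [sf m|sf vs].
  elim: m f sf => //= m IH f sf; split=> [x Ax|v]; first exact: (sf [::]).
  (* [foldr] applies the last direction first, so the innermost derivative is an entry appended at
     the end of the list. *)
  by apply: IH => vs x Ax; have := sf (rcons vs v) x Ax; rewrite foldr_rcons.
elim/last_ind: vs f sf => [|vs v IH] f sf x Ax.
  by have [/(_ x Ax)] := sf 1%N.
by rewrite foldr_rcons; apply: (IH ('D_v f)) => // m; have [_ +] := sf m.+1; apply.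
Qed.

Lemma smooth_on_differentiable V (A : set V) (f : V -> R) x :
  smooth_on A f -> A x -> differentiable f x.
Proof. by move=> sf; exact: (sf [::]). Qed.

Lemma smooth_on_derive V (A : set V) (f : V -> R) v :
  smooth_on A f -> smooth_on A ('D_v f).
Proof. by move=> /smooth_onP sf; apply/smooth_onP => m; have [_ +] := sf m.+1; apply. Qed.

Lemma smooth_on_continuous V (A : set V) (f : V -> R) x :
  smooth_on A f -> A x -> {for x, continuous f}.
Proof.
by move=> sf /(smooth_on_differentiable sf); exact: differentiable_continuous.
Qed.

Lemma smooth_on_sub V (A B : set V) (f : V -> R) :
  B `<=` A -> smooth_on A f -> smooth_on B f.
Proof. by move=> BA sf vs x /BA; exact: sf. Qed.

(** Product and quotient rules contain the undifferentiated factors, to which the induction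
    hypothesis applies only after lowering the order. *)
Lemma diffn_on_pred V m (A : set V) f : diffn_on m.+1 A f -> diffn_on m A f.
Proof.
elim: m f => //= m IH f [df Df]; split=> // v.
exact/IH.
Qed.

Section Open.
Variables (V : normedModType R) (A : set V).
Hypothesis oA : open A.

Lemma diffn_on_eq m f g :
  (forall x, A x -> f x = g x) -> diffn_on m A f -> diffn_on m A g.
Proof.
elim: m f g => //= m IH f g fg [df Df].
have nfg x : A x -> \forall y \near x, f y = g y.
  by move=> Ax; apply: filterS fg _; exact: open_nbhs_nbhs.
split=> [x Ax|v].
  by apply: near_eq_differentiable (df x Ax); exact: nfg.
by apply: IH (Df v) => x Ax; apply: near_eq_derive; exact: nfg.
Qed.

Lemma diffn_on_cst m (c : R) : diffn_on m A (cst c).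
Proof.
elim: m c => //= m IH c; split=> // v.
by rewrite (_ : 'D_v (cst c) = cst 0)//; apply/funext => x; rewrite derive_cst.
Qed.

Lemma diffn_on_linear m (f : V -> R) : linear f -> continuous f ->
  diffn_on m A f.
Proof.
move=> lf cf; case: m => //= m; split=> [x _|v].
  by have [] := linear_diff_derive lf cf x.
rewrite (_ : 'D_v f = cst (f v)); first exact: diffn_on_cst.
by apply/funext => x; have [_ ->] := linear_diff_derive lf cf x.
Qed.

Lemma diffn_onD m f g : diffn_on m A f -> diffn_on m A g ->
  diffn_on m A (fun x => f x + g x).
Proof.
elim: m f g => //= m IH f g [df Df] [dg Dg]; split=> [x Ax|v].
  by apply: differentiableD; [exact: df|exact: dg].
apply: diffn_on_eq (IH _ _ (Df v) (Dg v)) => x Ax; apply/esym.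
by apply: deriveD; apply: diff_derivable; [exact: df|exact: dg].
Qed.

Lemma diffn_onM m f g : diffn_on m A f -> diffn_on m A g ->
  diffn_on m A (fun x => f x * g x).
Proof.
elim: m f g => //= m IH f g fS gS.
have [df Df] := fS; have [dg Dg] := gS; split=> [x Ax|v].
  by apply: differentiableM; [exact: df|exact: dg].
have f' := diffn_on_pred fS; have g' := diffn_on_pred gS.
apply: diffn_on_eq (diffn_onD (IH _ _ f' (Dg v)) (IH _ _ g' (Df v))) => x Ax.
apply/esym.
by apply: deriveM; apply: diff_derivable; [exact: df|exact: dg].
Qed.

Lemma diffn_onN m f : diffn_on m A f -> diffn_on m A (fun x => - f x).
Proof.
move=> /(diffn_onM (diffn_on_cst m (-1))); apply: diffn_on_eq => x _.
by rewrite /= mulN1r.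
Qed.

Lemma diffn_onV m f : (forall x, A x -> f x != 0) -> diffn_on m A f ->
  diffn_on m A (fun x => (f x)^-1).
Proof.
move=> f0; elim: m => //= m IH [df Df]; split=> [x Ax|v].
  by apply: differentiableV; [exact: df|exact: f0].
have iV := IH (diffn_on_pred (conj df Df)).
apply: diffn_on_eq (diffn_onN (diffn_onM (diffn_onM iV iV) (Df v))) => x Ax.
rewrite deriveV; [|exact: f0|exact/diff_derivable/df].
by rewrite expr2 scaleNr invfM.
Qed.

Lemma diffn_on_sum m (I : Type) (r : seq I) (F : I -> V -> R) :
  (forall i, diffn_on m A (F i)) ->
  diffn_on m A (fun x => \sum_(i <- r) F i x).
Proof.
move=> dF; elim: r => [|i r IH].
  by apply: diffn_on_eq (diffn_on_cst m 0) => x _; rewrite big_nil.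
by apply: diffn_on_eq (diffn_onD (dF i) IH) => x _; rewrite big_cons.
Qed.

(** The derivative of the composite involves the functions ['D_(e i) J], again composed with the
    same [Phi]; hence the induction on the order lets [J] vary. *)
Lemma diffn_on_comp m W (B : set W) (I : finType) (Phi : V -> W)
    (phi : I -> V -> R) (e : I -> W) (J : W -> R) :
  (forall z, Phi z = \sum_i phi i z *: e i) ->
  (forall z, A z -> B (Phi z)) ->
  (forall i, diffn_on m A (phi i)) -> diffn_on m B J ->
  diffn_on m A (fun z => J (Phi z)).
Proof.
move=> PhiE AB; elim: m J => //= m IH J dphi [dJ DJ].
have dp i x : A x -> differentiable (phi i) x by have [+ _] := dphi i; apply.
split=> [x Ax|v].
  apply: (@differentiable_comp _ _ _ _ Phi J); last exact/dJ/AB.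
  by apply: (differentiable_coords PhiE) => i; exact: dp.
have S : diffn_on m A
    (fun z => \sum_i 'D_(e i) J (Phi z) * 'D_v (phi i) z).
  apply: diffn_on_sum => i; apply: diffn_onM; last by have [_ +] := dphi i; apply.
  apply: (IH ('D_(e i) J)); [move=> j; exact: diffn_on_pred (dphi j)|exact: DJ].
apply: diffn_on_eq S => x Ax; apply/esym.
by apply: (derive_comp_coords PhiE) => [i|]; [exact: dp|exact/dJ/AB].
Qed.

End Open.
End FiniteSmoothness.

Section SmoothOn.
Variables (R : realType) (V : normedModType R) (A : set V).
Hypothesis oA : open A.
Implicit Types f g : V -> R.

Lemma smooth_on_eq f g :
  (forall x, A x -> f x = g x) -> smooth_on A f -> smooth_on A g.
Proof.
by move=> fg /smooth_onP sf; apply/smooth_onP => m; exact: diffn_on_eq (sf m).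
Qed.

Lemma smooth_on_linear f : linear f -> continuous f -> smooth_on A f.
Proof. by move=> lf cf; apply/smooth_onP => m; exact: diffn_on_linear. Qed.

Lemma smooth_on_cst c : smooth_on A (fun _ : V => c).
Proof. by apply/smooth_onP => m; exact: diffn_on_cst. Qed.

Lemma smooth_onD f g : smooth_on A f -> smooth_on A g ->
  smooth_on A (fun x => f x + g x).
Proof.
move=> /smooth_onP sf /smooth_onP sg; apply/smooth_onP => m.
exact: diffn_onD.
Qed.

Lemma smooth_onM f g : smooth_on A f -> smooth_on A g ->
  smooth_on A (fun x => f x * g x).
Proof.
move=> /smooth_onP sf /smooth_onP sg; apply/smooth_onP => m.
exact: diffn_onM.
Qed.

Lemma smooth_onN f : smooth_on A f -> smooth_on A (fun x => - f x).
Proof.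
by move=> /smooth_onP sf; apply/smooth_onP => m; exact: diffn_onN.
Qed.

Lemma smooth_onX f n : smooth_on A f -> smooth_on A (fun x => f x ^+ n).
Proof.
move=> sf; elim: n => [|n IH]; first exact: (smooth_on_cst 1).
by apply: smooth_on_eq (smooth_onM sf IH) => x _; rewrite exprS.
Qed.

Lemma smooth_onV f : (forall x, A x -> f x != 0) -> smooth_on A f ->
  smooth_on A (fun x => (f x)^-1).
Proof.
by move=> f0 /smooth_onP sf; apply/smooth_onP => m; exact: diffn_onV.
Qed.

Lemma smooth_on_sum (I : Type) (r : seq I) (F : I -> V -> R) :
  (forall i, smooth_on A (F i)) -> smooth_on A (fun x => \sum_(i <- r) F i x).
Proof.
move=> sF; apply/smooth_onP => m; apply: diffn_on_sum => // i.
exact: (smooth_onP _ _).1.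
Qed.

Lemma smooth_on_comp (W : normedModType R) (B : set W) (I : finType)
    (Phi : V -> W) (phi : I -> V -> R) (e : I -> W) (J : W -> R) :
  (forall z, Phi z = \sum_i phi i z *: e i) ->
  (forall z, A z -> B (Phi z)) ->
  (forall i, smooth_on A (phi i)) -> smooth_on B J ->
  smooth_on A (fun z => J (Phi z)).
Proof.
move=> PhiE AB sphi /smooth_onP sJ; apply/smooth_onP => m.
by apply: (diffn_on_comp oA PhiE AB) => // i; exact: (smooth_onP _ _).1.
Qed.

End SmoothOn.

(** * Symmetry of second derivatives *)

Section Schwarz.
Variables (R : realType) (V : normedModType R).
Implicit Types (f : V -> R) (v w z : V).

Lemma is_derive_line f z v (s : R) : differentiable f (z + s *: v) ->
  is_derive s (1 : R) (fun s => f (z + s *: v)) ('D_v f (z + s *: v)).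
Proof.
move=> df; have dl : is_derive s (1 : R) (fun s : R => z + s *: v) v.
  have -> : (fun s : R => z + s *: v) = cst z + ( *:%R ^~ v) by [].
  have ds : is_derive s (1 : R) ( *:%R ^~ v : R -> V) v.
    apply: DeriveDef; first exact/diff_derivable.
    by rewrite deriveE// diff_val scale1r.
  apply: (is_derive_eq (@is_deriveD _ _ _ _ _ _ _ _ _
    (is_derive_cst z s (1 : R)) ds)).
  exact: add0r.
have dl' : differentiable (fun s : R => z + s *: v) s.
  by apply/derivable1_diffP; exact: ex_derive.
apply: DeriveDef; last by rewrite (derive_comp _ dl' df) derive_val.
apply: diff_derivable.
exact: (@differentiable_comp _ _ _ _ (fun s : R => z + s *: v) f).
Qed.

Lemma MVT_line f z v (h : R) : 0 < h ->
  (forall s, 0 <= s <= h -> differentiable f (z + s *: v)) ->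
  exists2 s, 0 <= s <= h & f (z + h *: v) - f z = 'D_v f (z + s *: v) * h.
Proof.
move=> h0 df.
have D s : 0 <= s <= h ->
  is_derive s (1 : R) (fun s => f (z + s *: v)) ('D_v f (z + s *: v)).
  by move=> sh; exact/is_derive_line/df.
have Doo (s : R) : s \in `]0, h[%R ->
    is_derive s (1 : R) (fun s => f (z + s *: v)) ('D_v f (z + s *: v)).
  by rewrite in_itv/= => /andP[s0 sh]; apply: D; rewrite !ltW.
have cl : {within `[0, h], continuous (fun s => f (z + s *: v))}.
  apply: derivable_within_continuous => s; rewrite in_itv/= => sh.
  by have [] := D s sh.
have [s] := MVT h0 Doo cl.
rewrite in_itv/= => /andP[s0 sh] E; exists s; first by rewrite !ltW.
by move: E; rewrite scale0r addr0 subr0.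
Qed.

(** The mean value theorem, applied along [v] to the increment of [f] in direction [w] and then
    along [w] to ['D_v f], turns the second difference into [h ^+ 2] times ['D_w ('D_v f)] at a
    nearby point. *)
Lemma second_difference (A : set V) f z v w (e : R) : open A ->
  smooth_on A f -> A z -> 0 < e ->
  \forall h \near 0^'+, `|f (z + h *: v + h *: w) - f (z + h *: v)
    - (f (z + h *: w) - f z) - 'D_w ('D_v f) z * h ^+ 2| <= e * h ^+ 2.
Proof.
move=> oA sf Az e0.
have sv := smooth_on_derive v sf; have svw := smooth_on_derive w sv.
have : \forall y \near z, A y /\ `|'D_w ('D_v f) z - 'D_w ('D_v f) y| <= e.
  near=> y; split; near: y; first exact: open_nbhs_nbhs.
  by have /cvgrPdist_le := smooth_on_continuous svw Az; exact.
move=> /nbhs_normP[d /= d0 zd].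
(* The summand 1 keeps the divisor positive when [v] and [w] both vanish. *)
have K0 : 0 < `|v| + `|w| + 1 by rewrite ltr_wpDl// addr_ge0.
near=> h.
have h0 : 0 < h by near: h; exact: nbhs_right_gt.
have hd : h * (`|v| + `|w| + 1) < d.
  by rewrite -ltr_pdivlMr//; near: h; apply: nbhs_right_lt; rewrite divr_gt0.
have near_z s t : 0 <= s <= h -> 0 <= t <= h ->
    A (z + s *: v + t *: w) /\
    `|'D_w ('D_v f) z - 'D_w ('D_v f) (z + s *: v + t *: w)| <= e.
  move=> /andP[s0 sh] /andP[t0 th]; apply: zd => /=.
  rewrite -addrA opprD addNKr normrN (le_lt_trans _ hd)//.
  rewrite (le_trans (ler_normD _ _))// !normrZ !ger0_norm// !mulrDr mulr1.
  have := ler_wpM2r (normr_ge0 v) sh; have := ler_wpM2r (normr_ge0 w) th.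
  by have := ltW h0; lra.
have near_z0 s : 0 <= s <= h -> A (z + s *: v).
  move=> sh; rewrite -[_ + _]addr0 -(scale0r w); apply: (near_z _ _ _ _).1 => //.
  by rewrite lexx ltW.
pose g y := f (y + h *: w) - f y.
have dg s : 0 <= s <= h -> differentiable g (z + s *: v) /\
  'D_v g (z + s *: v) = 'D_v f (z + s *: v + h *: w) - 'D_v f (z + s *: v).
  move=> sh; have hh : 0 <= h <= h by rewrite lexx ltW.
  have d1 : differentiable f (z + s *: v + h *: w).
    by apply: smooth_on_differentiable sf _; exact: (near_z _ _ sh hh).1.
  have d2 : differentiable f (z + s *: v).
    by apply: smooth_on_differentiable sf _; exact: near_z0.
  have ds : differentiable (shift (h *: w)) (z + s *: v) by [].
  have Ds : 'D_v (shift (h *: w)) (z + s *: v) = v.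
    by rewrite [shift _]/(id + cst _) deriveD// derive_id derive_cst addr0.
  have d3 : differentiable (fun y => f (y + h *: w)) (z + s *: v).
    exact: (@differentiable_comp _ _ _ _ (shift (h *: w)) f).
  split; first exact: differentiableB.
  rewrite [g]/((fun y => f (y + h *: w)) - f) deriveB; try exact: diff_derivable.
  by rewrite (derive_comp _ ds)// Ds.
have [s sh E1] := MVT_line h0 (fun s sh => (dg s sh).1).
have [t th E2] := @MVT_line ('D_v f) (z + s *: v) w h h0
  (fun t th => smooth_on_differentiable sv (near_z _ _ sh th).1).
have -> : f (z + h *: v + h *: w) - f (z + h *: v) - (f (z + h *: w) - f z)
  = 'D_w ('D_v f) (z + s *: v + t *: w) * h ^+ 2.
  by rewrite -[LHS]/(g _ - g z) E1 (dg s sh).2 E2 -mulrA -expr2.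
rewrite -mulrBl normrM [`|h ^+ 2|]ger0_norm ?sqr_ge0// distrC.
by rewrite ler_wpM2r ?sqr_ge0//; exact: (near_z _ _ sh th).2.
Unshelve. all: by end_near. Qed.

Lemma derive_schwarz (A : set V) f z v w : open A -> smooth_on A f -> A z ->
  'D_w ('D_v f) z = 'D_v ('D_w f) z.
Proof.
move=> oA sf Az; apply/eqP; rewrite -subr_eq0 -normr_le0.
apply/ler_addgt0Pr => e e0; rewrite add0r.
have e2 : 0 < e / 2 by rewrite divr_gt0.
have Nvw := second_difference v w oA sf Az e2.
have Nwv := second_difference w v oA sf Az e2.
have [h [[/= hgt0 Evw] Ewv]] :=
  filter_ex (filterI (filterI (nbhs_right_gt (0 : R)) Nvw) Nwv).
have h0 : 0 < h ^+ 2 by rewrite exprn_gt0.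
(* The second difference is symmetric in [v] and [w]; divided by [h ^+ 2], it is within [e / 2] of
   either mixed derivative. *)
have {}Ewv : `|f (z + h *: v + h *: w) - f (z + h *: v)
    - (f (z + h *: w) - f z) - 'D_v ('D_w f) z * h ^+ 2| <= e / 2 * h ^+ 2.
  move: Ewv; rewrite [z + h *: w + _]addrAC.
  move: (f (z + h *: v + h *: w)) (f (z + h *: v)) (f (z + h *: w)) (f z).
  move=> a b c d.
  by rewrite (_ : a - b - (c - d) = a - c - (b - d)) //; ring.
move: Evw Ewv; move: (_ - (f (z + h *: w) - f z)) => x.
move: ('D_w _ z) ('D_v _ z) (h ^+ 2) h0 => a b c c0 xa xb.
rewrite -(ler_pM2r c0); apply: (@le_trans _ _ `|a * c - b * c|).
  by rewrite -mulrBl normrM (gtr0_norm c0).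
apply: (le_trans (ler_distD x _ _)); rewrite [`|a * c - x|]distrC.
by apply: (le_trans (lerD xa xb)); rewrite -mulrDl -splitr.
Qed.

End Schwarz.

(** * Jets and total derivatives along solutions *)

Section JetCoordinates.
Variable R : realType.

(** One finite index type for all coordinates, so that jets fit the chain rule for finite
    combinations of fixed vectors. *)
Definition jet_basis k (j : bool + 'I_3 * 'I_k.+1) : jet R k :=
  match j with
  | inl b => ((if b then (1, 0) else (0, 1)), 0)
  | inr (a, i) => (0, 0, delta_mx a i)
  end.

Definition jet_coef k (t r : R) (m : 'I_3 -> 'I_k.+1 -> R)
    (j : bool + 'I_3 * 'I_k.+1) : R :=
  match j with
  | inl b => if b then t else r
  | inr (a, i) => m a i
  end.

Lemma jet_coefE k t r (m : 'I_3 -> 'I_k.+1 -> R) :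
  (t, r, \matrix_(a, i) m a i) = \sum_j jet_coef t r m j *: jet_basis j.
Proof.
rewrite big_sumType big_bool /=.
have -> : \sum_j jet_coef t r m (inr j) *: jet_basis (inr j)
    = (0, 0, \matrix_(a, i) m a i).
  rewrite [\matrix_(a, i) m a i]matrix_sum_delta pair_big/=.
  rewrite (big_morph (fun M : 'M[R]_(3, k.+1) => (0, 0, M) : jet R k)
    (id1 := 0) (op1 := +%R))//.
    apply: eq_bigr => -[a i] _ /=; rewrite mxE.
    by congr (_, _, _); rewrite /= scaler0.
  by move=> x y /=; congr (_, _, _); rewrite /= addr0.
congr (_, _, _); rewrite /= ?scaler0 ?addr0 ?add0r //; exact/esym/mulr1.
Qed.

Lemma jcoord_linear k a i : linear (@jcoord R k a i).
Proof. by move=> c x y; rewrite /jcoord/= !mxE. Qed.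

Lemma jcoord_continuous k a i : continuous (@jcoord R k a i).
Proof.
move=> x; apply: (@continuous_comp _ _ _ snd
  (fun M : 'M[R]_(3, k.+1) => M a (inord i))); first exact: cvg_snd.
exact: coord_continuous.
Qed.

Lemma differentiable_jcoord k a i (x : jet R k) : differentiable (jcoord a i) x.
Proof.
by have [] := linear_diff_derive (@jcoord_linear k a i) (@jcoord_continuous k a i) x.
Qed.

Lemma jrad_linear k : linear (@jrad R k).
Proof. by []. Qed.

Lemma jrad_continuous k : continuous (@jrad R k).
Proof.
move=> x; apply: (@continuous_comp _ _ _ fst snd); first exact: cvg_fst.
exact: cvg_snd.
Qed.

Lemma jtime_continuous k : continuous (fun x : jet R k => x.1.1).
Proof.
move=> x; apply: (@continuous_comp _ _ _ fst fst); first exact: cvg_fst.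
exact: cvg_fst.
Qed.

Section SmoothCoordinates.
Variables (k : nat) (A : set (jet R k)).

Lemma smooth_on_jcoord a i : smooth_on A (@jcoord R k a i).
Proof.
exact: smooth_on_linear (@jcoord_linear k a i) (@jcoord_continuous k a i).
Qed.

Lemma smooth_on_jrad : smooth_on A (@jrad R k).
Proof. exact: smooth_on_linear (@jrad_linear k) (@jrad_continuous k). Qed.

Lemma smooth_on_jtime : smooth_on A (fun x : jet R k => x.1.1).
Proof. exact: smooth_on_linear (@jtime_continuous k). Qed.

End SmoothCoordinates.

Lemma smooth_on_trunc k l (A : set (jet R k)) (B : set (jet R l)) F :
  open A -> (forall y, A y -> B (trunc l y)) -> smooth_on B F ->
  smooth_on A (fun y => F (trunc l y)).
Proof.
move=> oA AB sF.
apply: (@smooth_on_comp _ _ _ oA _ B _ _ (fun j y =>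
  jet_coef y.1.1 y.1.2 (fun a (i : 'I_l.+1) => jcoord a i y) j)
  (@jet_basis l)) => //.
  by move=> [[t r] m]; exact: jet_coefE.
case=> [[]|[a i]] /=.
- exact: smooth_on_jtime.
- exact: smooth_on_jrad.
- exact: smooth_on_jcoord.
Qed.

Lemma smooth_on_Dr k (A : set (jet R k)) (B : set (jet R k.+1)) F :
  open A -> open B -> (forall y, B y -> A (trunc k y)) -> smooth_on A F ->
  smooth_on B (Dr F).
Proof.
move=> oA oB BA sF; apply: smooth_onD => //.
  by apply: smooth_on_trunc BA _ => //; exact: smooth_on_derive.
apply: smooth_on_sum => // a; apply: smooth_on_sum => // i.
apply: smooth_onM => //; last exact: smooth_on_jcoord.
by apply: smooth_on_trunc BA _ => //; exact: smooth_on_derive.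
Qed.

Lemma jcoord_jet_of k u t r a i : (i <= k)%N ->
  jcoord a i (jet_of k u t r : jet R k) = derive1n i (u a t) r.
Proof. by move=> ik; rewrite /jcoord/= mxE inordK. Qed.

Lemma jcoord_trunc k l (y : jet R k) a i : (i <= l)%N ->
  jcoord a i (trunc l y) = jcoord a i y.
Proof. by move=> il; rewrite /jcoord/= mxE /jcoord inordK. Qed.

End JetCoordinates.

Section FlowStates.
Variables (R : realType) (P : set (R * R)) (p : R * R -> R) (n : nat).
Hypotheses (oP : open P) (sp : smooth_on P p).

(* The domain of the right-hand sides of the Euler equations. *)
Definition flow_jets k : set (jet R k) :=
  [set x | [/\ 0 < jrad x, 0 < jdens x & P (jdens x, jentr x)]].

Lemma open_flow_jets k : open (@flow_jets k).
Proof.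
rewrite (_ : flow_jets (k := k) = (@jrad R k) @^-1` [set r | 0 < r] `&`
  ((@jdens R k) @^-1` [set r | 0 < r] `&`
  (fun x : jet R k => (jdens x, jentr x)) @^-1` P)); last first.
  by apply/seteqP; split=> x /= => [[]|[? []]].
apply: openI.
  by apply: open_comp; [move=> *; exact: jrad_continuous|exact: open_gt].
apply: openI.
  by apply: open_comp; [move=> *; exact: jcoord_continuous|exact: open_gt].
apply: open_comp => // x _.
have rhoc := @jcoord_continuous R k irho 0 x.
by have := cvg_pair rhoc (@jcoord_continuous R k iS 0 x); exact.
Qed.

Lemma flow_jets_trunc k l (y : jet R k) :
  flow_jets y -> flow_jets (trunc l y).
Proof.
move=> [r0 d0 Py]; split=> //; first by rewrite /jdens jcoord_trunc.
by rewrite /jdens /jentr !jcoord_trunc.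
Qed.

Lemma smooth_on_state k q : smooth_on P q ->
  smooth_on (@flow_jets k) (fun x => q (jdens x, jentr x)).
Proof.
move=> sq; have oF := @open_flow_jets k.
apply: (@smooth_on_comp _ _ _ oF _ P bool _
  (fun b => if b then @jdens R k else @jentr R k)
  (fun b => if b then (1, 0) else (0, 1))) => //.
- move=> x; rewrite big_bool /=.
  congr (_, _); rewrite /= ?scaler0 ?addr0 ?add0r //; exact/esym/mulr1.
- by move=> x [].
- by case; exact: smooth_on_jcoord.
Qed.

Lemma smooth_on_euler_rhs a : smooth_on (@flow_jets 1) (euler_rhs n p a).
Proof.
have oF := @open_flow_jets 1; have oF0 := @open_flow_jets 0.
have sc b i k : smooth_on (@flow_jets k) (@jcoord R k b i).
  exact: smooth_on_jcoord.
have sv k : smooth_on (@flow_jets k) (@jvel R k) by exact: sc.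
have sd k : smooth_on (@flow_jets k) (@jdens R k) by exact: sc.
rewrite /euler_rhs; case: (a == iU).
  apply: smooth_onN => //; apply: smooth_onD => //.
    by apply: smooth_onM => //.
  apply: smooth_onM => //; last first.
    apply: smooth_onV => //; by move=> x [_ d0 _]; rewrite gt_eqF.
  apply: smooth_onD => //.
    apply: smooth_onM => //.
    exact: (smooth_on_state (@smooth_on_derive _ _ _ _ ((0, 1) : R * R) sp)).
  apply: smooth_onM => //.
  exact: (smooth_on_state (@smooth_on_derive _ _ _ _ ((1, 0) : R * R) sp)).
case: (a == irho).
  apply: smooth_onN => //; apply: smooth_onD => //.
    apply: (smooth_on_Dr oF0) => //; first by move=> y; exact: flow_jets_trunc.
    by apply: smooth_onM => //.
  apply: smooth_onM => //; last by apply: smooth_onM => //.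
  apply: smooth_onM => //; first exact: smooth_on_cst.
  apply: smooth_onV => //; last exact: smooth_on_jrad.
  by move=> x [r0 _ _]; rewrite gt_eqF.
by apply: smooth_onN => //; apply: smooth_onM => //.
Qed.

(** Evaluating one more [Dr] along a solution is an instance of the chain rule, which requires the
    previous iterate to be differentiable at the jets of the solution. *)
Lemma smooth_on_Dr_iter a i :
  smooth_on (@flow_jets (i + 1)) (@Dr_iter R i 1 (euler_rhs n p a)).
Proof.
elim: i => [|i IH]; first exact: smooth_on_euler_rhs.
apply: smooth_on_Dr IH; [exact: open_flow_jets|exact: open_flow_jets|].
by move=> y; exact: flow_jets_trunc.
Qed.

End FlowStates.

(** * Partial derivatives in the (t, r) plane *)

Section Slices.
Variable R : realType.
Implicit Types (f : R * R -> R) (A : set (R * R)).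

Definition dt f : R * R -> R := 'D_((1, 0) : R * R) f.
Definition dr f : R * R -> R := 'D_((0, 1) : R * R) f.

Lemma smooth_on_dt A f : smooth_on A f -> smooth_on A (dt f).
Proof. exact: smooth_on_derive. Qed.

Lemma smooth_on_dr A f : smooth_on A f -> smooth_on A (dr f).
Proof. exact: smooth_on_derive. Qed.

(** Both sides are the limit of the same difference quotient. This links the one-variable
    derivatives in the Euler equations with the directional derivatives in [smooth_on]. *)
Lemma derive1_dr f t r : derive1 (fun s => f (t, s)) r = dr f (t, r).
Proof.
rewrite derive1E /dr /derive.
have E : (fun h : R => h^-1 *: (((fun s => f (t, s)) \o shift r) (h *: (1 : R))
    - f (t, r))) = fun h => h^-1 *: ((f \o shift (t, r)) (h *: (0, 1)) - f (t, r)).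
  apply/funext => h /=.
  by congr (_ *: (f (_, _) - _)); rewrite /= ?scaler0 ?add0r.
by rewrite E.
Qed.

Lemma derive1_dt f t r : derive1 (fun s => f (s, r)) t = dt f (t, r).
Proof.
rewrite derive1E /dt /derive.
have E : (fun h : R => h^-1 *: (((fun s => f (s, r)) \o shift t) (h *: (1 : R))
    - f (t, r))) = fun h => h^-1 *: ((f \o shift (t, r)) (h *: (1, 0)) - f (t, r)).
  apply/funext => h /=.
  by congr (_ *: (f (_, _) - _)); rewrite /= ?scaler0 ?add0r.
by rewrite E.
Qed.

Lemma slice_r_continuous (t r : R) : {for r, continuous (fun s => (t, s))}.
Proof.
have c : cst t x @[x --> r] --> t by exact: cvg_cst.
by have := cvg_pair c (@cvg_id _ (nbhs r)); exact.
Qed.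

Lemma slice_t_continuous (t r : R) : {for t, continuous (fun s => (s, r))}.
Proof.
have c : cst r x @[x --> t] --> r by exact: cvg_cst.
by have := cvg_pair (@cvg_id _ (nbhs t)) c; exact.
Qed.

Lemma near_slice_r (B : set (R * R)) (t r : R) : nbhs (t, r) B ->
  \forall s \near r, B (t, s).
Proof. by move=> tB; have := @slice_r_continuous t r B tB. Qed.

Lemma is_derive_dr f t r : differentiable f (t, r) ->
  is_derive r (1 : R) (fun s => f (t, s)) (dr f (t, r)).
Proof.
move=> df; have := @is_derive_line _ _ f (t, 0) (0, 1) r.
have E s : (t, 0) + s *: ((0, 1) : R * R) = (t, s).
  by congr (_, _); rewrite /= ?scaler0 ?addr0 ?add0r// [_ *: 1]mulr1.
by under eq_fun do rewrite E; rewrite E; exact.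
Qed.

Lemma is_derive_dt f t r : differentiable f (t, r) ->
  is_derive t (1 : R) (fun s => f (s, r)) (dt f (t, r)).
Proof.
move=> df; have := @is_derive_line _ _ f (0, r) (1, 0) t.
have E s : (0, r) + s *: ((1, 0) : R * R) = (s, r).
  by congr (_, _); rewrite /= ?scaler0 ?addr0 ?add0r// [_ *: 1]mulr1.
by under eq_fun do rewrite E; rewrite E; exact.
Qed.

End Slices.

Section JetField.
Variables (R : realType) (u : 'I_3 -> R -> R -> R) (W : set (R * R)).
Hypothesis oW : open W.
Hypothesis su : forall a, smooth_on W (fun z : R * R => u a z.1 z.2).

(** Directional derivatives in the plane, rather than iterated derivatives of slices: on [W] they
    are smooth functions of (t, r), and Schwarz applies to them. *)
Definition field_dr a i : R * R -> R :=
  iter i (@dr R) (fun z => u a z.1 z.2).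

Lemma smooth_on_field_dr a i : smooth_on W (field_dr a i).
Proof. by elim: i => [|i IH] //=; exact: smooth_on_derive. Qed.

Lemma derive1n_field a i t r : W (t, r) ->
  derive1n i (u a t) r = field_dr a i (t, r).
Proof.
elim: i r => [|i IH] r Wtr //; rewrite derive1nS /= -derive1_dr !derive1E.
apply: near_eq_derive; have := open_nbhs_nbhs (conj oW Wtr).
by move=> /near_slice_r; apply: filterS => s; exact: IH.
Qed.

Definition jet_field k (z : R * R) : jet R k :=
  (z.1, z.2, \matrix_(a < 3, i < k.+1) field_dr a i z).

Lemma jet_fieldE k t r : W (t, r) -> jet_of k u t r = jet_field k (t, r).
Proof.
move=> Wtr; congr (_, _); apply/matrixP => a i; rewrite !mxE.
exact: derive1n_field.
Qed.

Let coef k (j : bool + 'I_3 * 'I_k.+1) (z : R * R) :=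
  jet_coef z.1 z.2 (fun a i => field_dr a (i : 'I_k.+1) z) j.

Lemma jet_field_sum k z : jet_field k z = \sum_j coef j z *: jet_basis R j.
Proof. exact: jet_coefE. Qed.

Lemma smooth_on_jet_coef k (j : bool + 'I_3 * 'I_k.+1) : smooth_on W (coef j).
Proof.
case: j => [[]|[a i]]; last exact: smooth_on_field_dr.
  by apply: smooth_on_linear => // x; exact: cvg_fst.
by apply: smooth_on_linear => // x; exact: cvg_snd.
Qed.

Lemma continuous_jet_field k z : W z -> {for z, continuous (jet_field k)}.
Proof.
move=> Wz; apply: differentiable_continuous.
apply: (differentiable_coords (@jet_field_sum k)) => j.
exact: smooth_on_differentiable (smooth_on_jet_coef j) Wz.
Qed.

Definition jet_preimage k (Om : set (jet R k)) : set (R * R) :=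
  W `&` jet_field k @^-1` Om.

Lemma open_jet_preimage k (Om : set (jet R k)) :
  open Om -> open (jet_preimage Om).
Proof.
move=> oOm; rewrite openE => z [Wz Omz].
apply: filterI; first exact: open_nbhs_nbhs.
apply: (continuous_jet_field Wz); exact: open_nbhs_nbhs.
Qed.

Lemma smooth_on_jet_field k (Om : set (jet R k)) F : open Om ->
  smooth_on Om F -> smooth_on (jet_preimage Om) (fun z => F (jet_field k z)).
Proof.
move=> oOm sF; apply: (smooth_on_comp (open_jet_preimage oOm)
  (@jet_field_sum k) _ _ sF) => [z []//|j].
by apply: smooth_on_sub (smooth_on_jet_coef j) => z [].
Qed.

Lemma derive_jet_field k (F : jet R k -> R) z v : W z ->
  differentiable F (jet_field k z) ->
  'D_v (fun z => F (jet_field k z)) z =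
    part_t F (jet_field k z) * v.1 + part_r F (jet_field k z) * v.2
    + \sum_(a < 3) \sum_(i < k.+1)
        part_v a i F (jet_field k z) * 'D_v (field_dr a i) z.
Proof.
move=> Wz dF; rewrite (derive_comp_coords (@jet_field_sum k)) => [|j|//].
  rewrite big_sumType big_bool pair_big/=; congr (_ * _ + _ * _ + _).
  - have lf : linear (fst : R * R -> R) by [].
    have cf : continuous (fst : R * R -> R) by move=> x; exact: cvg_fst.
    by have [_] := linear_diff_derive lf cf z; exact.
  - have lf : linear (snd : R * R -> R) by [].
    have cf : continuous (snd : R * R -> R) by move=> x; exact: cvg_snd.
    by have [_] := linear_diff_derive lf cf z; exact.
  - by apply: eq_bigr => -[a i] _.
exact: smooth_on_differentiable (smooth_on_jet_coef j) Wz.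
Qed.

Lemma jcoord_jet_field k a i z : (i <= k)%N ->
  jcoord a i (jet_field k z) = field_dr a i z.
Proof. by move=> ik; rewrite /jcoord/= mxE inordK. Qed.

Lemma trunc_jet_field k l z : (l <= k)%N ->
  trunc l (jet_field k z) = jet_field l z.
Proof.
move=> lk; congr (_, _).
apply/matrixP => a i; rewrite !mxE jcoord_jet_field//.
by rewrite (leq_trans _ lk)// -ltnS.
Qed.

Lemma Dr_jet_field k (F : jet R k -> R) z : W z ->
  differentiable F (jet_field k z) ->
  Dr F (jet_field k.+1 z) = dr (fun z => F (jet_field k z)) z.
Proof.
move=> Wz dF; rewrite /dr (derive_jet_field (0, 1) Wz dF).
rewrite [X in X + _ + _]mulr0 [X in _ + X + _]mulr1 add0r.
rewrite /Dr trunc_jet_field//; congr (_ + _).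
apply: eq_bigr => a _; apply: eq_bigr => i _.
by rewrite jcoord_jet_field.
Qed.

(** Schwarz moves [dt] past one [dr] at a time; as [W] is open, the identity for [i] holds near [z]
    and may be differentiated. *)
Lemma dt_field_dr a i z : W z ->
  dt (field_dr a i) z = iter i (@dr R) (dt (fun z => u a z.1 z.2)) z.
Proof.
elim: i z => [//|i IH] z Wz.
rewrite /= [LHS](derive_schwarz _ _ oW (smooth_on_field_dr a i) Wz).
apply: near_eq_derive.
by apply: filterS (open_nbhs_nbhs (conj oW Wz)) => y; exact: IH.
Qed.

End JetField.

Section EulerSolution.
Variables (R : realType) (n : nat) (P : set (R * R)) (p : R * R -> R).
Hypotheses (oP : open P) (sp : smooth_on P p).
Variables (u : 'I_3 -> R -> R -> R) (W : set (R * R)).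
Hypothesis sol : euler_solution n p P u W.

Let oW : open W. Proof. by case: sol. Qed.
Let su a : smooth_on W (fun z : R * R => u a z.1 z.2).
Proof. by case: sol. Qed.

Lemma flow_jets_jet_field k z : W z -> flow_jets P (jet_field u k z).
Proof.
case: z => t r Wz; have [_ _ /(_ _ _ Wz)[r0 d0 Pz] _] := sol.
by rewrite -(jet_fieldE u oW)//; split=> //; rewrite /jdens /jentr !jcoord_jet_of.
Qed.

Lemma euler_rhs_jet_field a z : W z ->
  euler_rhs n p a (jet_field u 1 z) = dt (fun z => u a z.1 z.2) z.
Proof.
case: z => t r Wz; have [_ _ _ /(_ _ _ Wz)[EU Erho ES]] := sol.
have /= := derive1_dt (fun z => u _ z.1 z.2) t r; move=> dtE.
rewrite -dtE /euler_rhs; case: eqP => [->|aU].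
  rewrite -(jet_fieldE u oW)// /jvel /jdens /jentr !jcoord_jet_of//.
  apply/eqP; rewrite eq_sym -addr_eq0; apply/eqP; rewrite -[RHS]EU addrA.
  by [].
case: eqP => [->|arho].
  have -> : Dr (fun z : jet R 0 => jvel z * jdens z) (jet_field u 1 (t, r))
      = derive1 (u iU t \* u irho t) r.
    rewrite (Dr_jet_field su)//; last first.
      exact: differentiableM (@differentiable_jcoord R 0 iU 0 _)
        (@differentiable_jcoord R 0 irho 0 _).
    rewrite -derive1_dr; congr (derive1 _ r); apply/funext => s.
    by rewrite /jvel /jdens /jcoord /= !mxE !inordK.
  rewrite -(jet_fieldE u oW)// /jvel /jdens !jcoord_jet_of//.
  by apply/eqP; rewrite eq_sym -addr_eq0; apply/eqP; rewrite -[RHS]Erho addrA.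
have -> : a = iS.
  case: a aU arho => -[|[|[|]]]// i aU arho; last exact/val_inj.
    by case: aU; exact/val_inj.
  by case: arho; exact/val_inj.
rewrite -(jet_fieldE u oW)// /jvel !jcoord_jet_of//.
by apply/eqP; rewrite eq_sym -addr_eq0; apply/eqP.
Qed.

(** The induction runs on the form with all [dr] outside [dt]: passing from [i] to [i.+1] is then
    differentiating in r an identity valid on the open set [W]. *)
Lemma Dr_iter_jet_field a i z : W z ->
  @Dr_iter R i 1 (euler_rhs n p a) (jet_field u (i + 1) z)
  = dt (field_dr u a i) z.
Proof.
move=> Wz; rewrite (dt_field_dr oW su)//; elim: i z Wz => [|i IH] z Wz.
  exact: euler_rhs_jet_field.
have -> : @Dr_iter R i.+1 1 (euler_rhs n p a) = Dr (@Dr_iter R i 1 (euler_rhs n p a)) by [].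
have sD := @smooth_on_Dr_iter R P p n oP sp a i.
rewrite [LHS](Dr_jet_field su)//; last first.
  apply: smooth_on_differentiable sD _; exact: flow_jets_jet_field.
rewrite [LHS]/dr /=; apply: near_eq_derive.
by apply: filterS (open_nbhs_nbhs (conj oW Wz)) => y; exact: IH.
Qed.

Lemma DtE_jet_field k (F : jet R k -> R) z : W z ->
  differentiable F (jet_field u k z) ->
  DtE n p F (jet_field u k.+1 z) = dt (fun z => F (jet_field u k z)) z.
Proof.
case: z => t r Wz dF.
rewrite [RHS](derive_jet_field su (1, 0) Wz dF).
rewrite [X in X + _ + _]mulr1 [X in _ + X + _]mulr0 addr0.
rewrite /DtE trunc_jet_field//; congr (_ + _).
apply: eq_bigr => a _; apply: eq_bigr => i _; congr (_ * _).
by rewrite trunc_jet_field ?Dr_iter_jet_field ?addn1.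
Qed.

End EulerSolution.

(** * The three differential conditions *)

Section Transport.
Variable R : realType.
Implicit Types f g m v q : R * R -> R.

Lemma derive_mul (V : normedModType R) (f g : V -> R) (x w : V) :
  differentiable f x -> differentiable g x ->
  'D_w (fun x => f x * g x) x = f x * 'D_w g x + g x * 'D_w f x.
Proof. by move=> df dg; apply: deriveM; exact: diff_derivable. Qed.

Definition material v f (z : R * R) : R := dt f z + v z * dr f z.
Definition balance v q (z : R * R) : R := dt q z + dr (fun z => v z * q z) z.

Lemma balance_mul v m f z : differentiable v z -> differentiable m z ->
  differentiable f z -> balance v m z = 0 ->
  balance v (fun z => m z * f z) z = m z * material v f z.
Proof.
move=> dv dm df; rewrite /balance /material /dt /dr.
rewrite (derive_mul _ dv dm) (derive_mul _ dm df).
have dmf : differentiable (fun z => m z * f z) z by exact: differentiableM.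
rewrite (derive_mul _ dv dmf) (derive_mul _ dm df) => E.
move: (v z) (m z) (f z) ('D_(1, 0) m z) ('D_(0, 1) m z) ('D_(0, 1) v z)
  ('D_(1, 0) f z) ('D_(0, 1) f z) E => a b c mt mr vr ft fr E.
(* The two sides differ by [f z] times [balance v m z]. *)
apply/eqP; rewrite -subr_eq0; apply/eqP; transitivity (c * (mt + (a * mr + b * vr))).
  by ring.
by rewrite E mulr0.
Qed.

Lemma material_inv v q z : differentiable v z -> differentiable q z ->
  q z != 0 ->
  material v (fun z => (q z)^-1) z - (q z)^-1 * dr v z
  = - (q z) ^- 2 * balance v q z.
Proof.
move=> dv dq q0; rewrite /material /balance /dt /dr (derive_mul _ dv dq).
rewrite !deriveV//; try exact: diff_derivable.
move: (v z) (q z) q0 ('D_(1, 0) q z) ('D_(0, 1) q z) ('D_(0, 1) v z).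
by move=> a b b0 qt qr vr; rewrite /GRing.scale /=; field.
Qed.

Lemma material_continuous (A : set (R * R)) v f z : A z ->
  smooth_on A v -> smooth_on A f -> {for z, continuous (material v f)}.
Proof.
move=> Az sv sf.
have ct := smooth_on_continuous (smooth_on_dt sf) Az.
have cr := smooth_on_continuous (smooth_on_dr sf) Az.
have cv := smooth_on_continuous sv Az.
exact: continuousD ct (continuousM cv cr).
Qed.

End Transport.

Section Invariants.
Variables (R : realType) (n : nat) (P : set (R * R)) (p : R * R -> R).
Hypotheses (n_gt1 : (1 < n)%N) (oP : open P) (sp : smooth_on P p).
Variables (k : nat) (Om : set (jet R k)) (J : jet R k -> R).
Hypotheses (oOm : open Om) (sJ : smooth_on Om J).

Definition velocity (u : 'I_3 -> R -> R -> R) (z : R * R) : R := u iU z.1 z.2.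

(* The mass per unit length, up to the area of the unit sphere. *)
Definition mass (u : 'I_3 -> R -> R -> R) (z : R * R) : R :=
  z.2 ^+ n.-1 * u irho z.1 z.2.

Section Solution.
Variables (u : 'I_3 -> R -> R -> R) (W : set (R * R)).
Hypothesis sol : euler_solution n p P u W.

Lemma solution_open : open W. Proof. by case: sol. Qed.

Lemma solution_smooth a : smooth_on W (fun z : R * R => u a z.1 z.2).
Proof. by case: sol. Qed.

Let oW := solution_open.
Let su := solution_smooth.

Lemma smooth_on_mass : smooth_on W (mass u).
Proof.
apply: smooth_onM => //.
by apply: smooth_onX => //; apply: smooth_on_linear => // x; exact: cvg_snd.
Qed.

Lemma mass_gt0 z : W z -> 0 < mass u z.
Proof.
case: z => t r Wz; have [_ _ /(_ _ _ Wz)[r0 d0 _] _] := sol.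
by rewrite mulr_gt0// exprn_gt0.
Qed.

Lemma mass_balance z : W z -> balance (velocity u) (mass u) z = 0.
Proof.
case: z => t r Wz; have [_ _ /(_ _ _ Wz)[r0 d0 _] /(_ _ _ Wz)[_ + _]] := sol.
have dU := smooth_on_differentiable (su iU) Wz.
have drho := smooth_on_differentiable (su irho) Wz.
have dm : differentiable (fun z => u iU z.1 z.2 * u irho z.1 z.2) (t, r).
  exact: differentiableM.
have dsnd : differentiable (fun z : R * R => z.2) (t, r).
  by have [] := @linear_diff_derive R _ _ (fun z : R * R => z.2) _
    (fun x => cvg_snd) (t, r).
have Dsnd w : 'D_w (fun z : R * R => z.2) (t, r) = w.2.
  by have [] := @linear_diff_derive R _ _ (fun z : R * R => z.2) _
    (fun x => cvg_snd) (t, r).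
have dX : differentiable (fun z : R * R => z.2 ^+ n.-1) (t, r).
  have ssnd : smooth_on W (fun z : R * R => z.2).
    by apply: smooth_on_linear => // x; exact: cvg_snd.
  exact: smooth_on_differentiable (smooth_onX oW n.-1 ssnd) Wz.
have DX w : 'D_w (fun z : R * R => z.2 ^+ n.-1) (t, r)
    = (n.-1)%:R * r ^+ n.-2 * w.2.
  have := deriveX n.-1 (@diff_derivable _ _ _ _ _ w dsnd).
  by rewrite exprfctE Dsnd.
have -> : derive1 (u irho ^~ r) t = dt (fun z => u irho z.1 z.2) (t, r).
  by rewrite -derive1_dt.
have -> : derive1 (u iU t \* u irho t) r
    = dr (fun z => u iU z.1 z.2 * u irho z.1 z.2) (t, r).
  by rewrite -derive1_dr.
rewrite /balance.
have -> : (fun z => velocity u z * mass u z)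
    = fun z : R * R => z.2 ^+ n.-1 * (u iU z.1 z.2 * u irho z.1 z.2).
  by apply/funext => z; rewrite /mass mulrCA.
rewrite /mass /dt /dr (derive_mul _ dX drho) (derive_mul _ dX dm) !DX /= mulr0.
rewrite mulr0 addr0 mulr1 => E.
(* Here [1 < n] enters: for [n = 1] both exponents are truncated to 0. *)
have Er : r ^+ n.-1 = r * r ^+ n.-2.
  by rewrite -exprS; case: n n_gt1 => [|[]].
(* The balance is [r ^+ n.-1] times the continuity equation: differentiating the weight produces the
   geometric term in [(n.-1)%:R / r]. *)
transitivity (r ^+ n.-1 * 0); last by rewrite mulr0.
rewrite -[X in _ = _ * X]E Er.
move: (derive _ _ _) (derive _ _ _) (u iU t r) (u irho t r) => a b c d.
by field; rewrite gt_eqF.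
Qed.

Let f z := J (jet_field u k z).
Let W' := jet_preimage u W Om.

Lemma smooth_on_invariant : smooth_on W' f.
Proof. exact: smooth_on_jet_field. Qed.

Lemma scalar_defect z : W' z ->
  DtE n p J (jet_field u k.+1 z) + jvel (jet_field u k.+1 z) *
    Dr J (jet_field u k.+1 z) = material (velocity u) f z.
Proof.
move=> [Wz Omz]; have dJ := smooth_on_differentiable sJ Omz.
by rewrite (DtE_jet_field oP sp sol)// (Dr_jet_field su)// /jvel jcoord_jet_field.
Qed.

Let J1 (x : jet R k) := jrad x ^+ n.-1 * jdens x * J x.
Let J2 (x : jet R k) := jrad x ^- n.-1 / (jdens x * J x).

Lemma J1_jet_field z : J1 (jet_field u k z) = mass u z * f z.
Proof. by rewrite /J1 /jdens jcoord_jet_field. Qed.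

(** Thanks to [0^-1 = 0] this holds at every point, zeros of [f] included, so it can be used as an
    equality of functions under a derivative. *)
Lemma J2_jet_field z : J2 (jet_field u k z) = (mass u z * f z)^-1.
Proof. by rewrite /J2 /jdens jcoord_jet_field// /mass !invfM mulrA. Qed.

Lemma differentiable_J1 x : Om x -> differentiable J1 x.
Proof.
move=> Omx; apply: differentiableM; last exact: smooth_on_differentiable sJ Omx.
apply: differentiableM; last exact: differentiable_jcoord.
by apply: smooth_on_differentiable (smooth_onX openT n.-1 (@smooth_on_jrad R k _)) _.
Qed.

Lemma differentiable_J2 x : Om x -> jrad x != 0 -> jdens x != 0 -> J x != 0 ->
  differentiable J2 x.
Proof.
move=> Omx r0 d0 J0; apply: differentiableM; apply: differentiableV.
- by apply: smooth_on_differentiable (smooth_onX openT n.-1 (@smooth_on_jrad R k _)) _.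
- by rewrite expf_neq0.
- apply: differentiableM; first exact: differentiable_jcoord.
  exact: smooth_on_differentiable sJ Omx.
- by rewrite mulf_neq0.
Qed.

Lemma one_form_defect z : W' z ->
  DtE n p J1 (jet_field u k.+1 z)
    + Dr (fun x => jvel x * J1 x) (jet_field u k.+1 z)
  = mass u z * material (velocity u) f z.
Proof.
move=> W'z; have [Wz Omz] := W'z; have dJ1 := differentiable_J1 Omz.
have dv : differentiable (velocity u) z.
  exact: smooth_on_differentiable (su iU) Wz.
have E1 : (fun y => J1 (jet_field u k y)) = fun y => mass u y * f y.
  by apply/funext => y; exact: J1_jet_field.
have E2 : (fun y => jvel (jet_field u k y) * J1 (jet_field u k y))
    = fun y => velocity u y * (mass u y * f y).
  by apply/funext => y; rewrite J1_jet_field /jvel jcoord_jet_field.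
rewrite (DtE_jet_field oP sp sol)// (Dr_jet_field su)//; last first.
  by apply: differentiableM => //; exact: differentiable_jcoord.
rewrite E1 E2 -balance_mul//; last exact: mass_balance.
  exact: smooth_on_differentiable smooth_on_mass Wz.
exact: smooth_on_differentiable smooth_on_invariant W'z.
Qed.

Lemma vector_defect z : W' z -> f z != 0 ->
  DtE n p J2 (jet_field u k.+1 z)
    + jvel (jet_field u k.+1 z) * Dr J2 (jet_field u k.+1 z)
    - J2 (trunc k (jet_field u k.+1 z)) * Dr (@jvel R k) (jet_field u k.+1 z)
  = - (mass u z * f z) ^- 2 * (mass u z * material (velocity u) f z).
Proof.
move=> W'z f0; have [Wz Omz] := W'z.
have dv : differentiable (velocity u) z.
  exact: smooth_on_differentiable (su iU) Wz.
have dm := smooth_on_differentiable smooth_on_mass Wz.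
have df := smooth_on_differentiable smooth_on_invariant W'z.
have dJ2 : differentiable J2 (jet_field u k z).
  have [r0 d0 _] := flow_jets_jet_field sol k Wz.
  by apply: differentiable_J2 => //; rewrite gt_eqF.
have E1 : (fun y => J2 (jet_field u k y)) = fun y => (mass u y * f y)^-1.
  by apply/funext => y; exact: J2_jet_field.
have E2 l : (fun y => @jvel R l (jet_field u l y)) = velocity u.
  by apply/funext => y; rewrite /jvel jcoord_jet_field.
have E3 : jvel (jet_field u k.+1 z) = velocity u z by rewrite -(E2 k.+1).
rewrite (DtE_jet_field oP sp sol)// !(Dr_jet_field su)//; last first.
  exact: differentiable_jcoord.
rewrite trunc_jet_field// E1 E2 E3 J2_jet_field.
rewrite -balance_mul//; last exact: mass_balance.
have dq : differentiable (fun y => mass u y * f y) z by exact: differentiableM.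
have q0 : mass u z * f z != 0 by rewrite mulf_neq0// gt_eqF// mass_gt0.
exact: (material_inv dv dq q0).
Qed.

End Solution.

(** Moves the condition from jets to a function of (t, r) on an open set, where continuity and
    integration arguments apply. *)
Lemma scalar_invariantP : scalar_invariant n p P Om J <->
  forall u W, euler_solution n p P u W -> forall z, jet_preimage u W Om z ->
    material (velocity u) (fun z => J (jet_field u k z)) z = 0.
Proof.
split=> [inv u W sol [t r] W'z|inv u W sol t r Wz Omz].
  have [Wz Omz] := W'z; rewrite -(scalar_defect sol)//.
  have E l := @jet_fieldE _ u _ (solution_open sol) l _ _ Wz.
  by rewrite -!E; apply: inv sol _ _ Wz _; rewrite E.
have E l := @jet_fieldE _ u _ (solution_open sol) l _ _ Wz.
rewrite !E in Omz *; rewrite (scalar_defect sol)//.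
exact: (inv _ _ sol).
Qed.

Lemma scalar_to_one_form : scalar_invariant n p P Om J ->
  one_form_invariant n p P Om (fun x => jrad x ^+ n.-1 * jdens x * J x).
Proof.
move=> /scalar_invariantP inv u W sol t r Wz Omz.
have E l := @jet_fieldE _ u _ (solution_open sol) l _ _ Wz.
rewrite !E in Omz *; rewrite (one_form_defect sol)//.
by rewrite (inv _ _ sol) ?mulr0.
Qed.

Lemma one_form_to_vector :
  one_form_invariant n p P Om (fun x => jrad x ^+ n.-1 * jdens x * J x) ->
  vector_invariant n p P (Om `&` [set x | J x != 0])
    (fun x => jrad x ^- n.-1 / (jdens x * J x)).
Proof.
move=> inv u W sol t r Wz [Omz f0].
have E l := @jet_fieldE _ u _ (solution_open sol) l _ _ Wz.
have := inv u W sol t r Wz Omz.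
rewrite !E in Omz f0 *; rewrite (one_form_defect sol)// => K0.
by rewrite (vector_defect sol)// K0 mulr0.
Qed.

(* The vector condition says nothing where [J] vanishes. But if the material
   derivative of [J] were nonzero at some point, then, being continuous, it
   would be nonzero nearby, so [J] would vanish nearby, a contradiction. *)
Lemma vector_to_scalar :
  vector_invariant n p P (Om `&` [set x | J x != 0])
    (fun x => jrad x ^- n.-1 / (jdens x * J x)) ->
  scalar_invariant n p P Om J.
Proof.
move=> inv; apply/scalar_invariantP => u W sol z W'z.
have oW := solution_open sol; have su := solution_smooth sol.
set f := fun z => J (jet_field u k z).
have K0 y : jet_preimage u W Om y -> f y != 0 ->
    material (velocity u) f y = 0.
  case: y => t r W'y f0; have [Wy Omy] := W'y.
  have E l := @jet_fieldE _ u _ oW l _ _ Wy.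
  have := inv u W sol t r Wy; rewrite !E => /(_ (conj Omy f0)).
  rewrite (vector_defect sol)// => /eqP; have m0 := mass_gt0 sol Wy.
  rewrite mulf_eq0 oppr_eq0 invr_eq0 expf_eq0/= mulf_eq0 (gt_eqF m0)/=.
  by rewrite (negbTE f0)/= mulf_eq0 (gt_eqF m0)/= => /eqP.
apply/eqP; apply: contrapT => /negP Kz.
have oW' := open_jet_preimage oW su oOm.
have sf : smooth_on (jet_preimage u W Om) f.
  exact: smooth_on_invariant.
have sv : smooth_on (jet_preimage u W Om) (velocity u).
  by apply: smooth_on_sub (su iU) => y [].
have fz : \forall y \near z, f y = cst 0 y.
  have := open_nbhs_nbhs (conj oW' W'z).
  have : \forall y \near z, material (velocity u) f y != 0.
    exact: cvgr_neq0 (material_continuous W'z sv sf) Kz.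
  apply: filterS2 => y Ky W'y; apply/eqP; apply: contrapT => /negP f0.
  by move: Ky; rewrite K0// eqxx.
move: Kz; rewrite /material /dt /dr !(near_eq_derive _ fz) !derive_cst.
by rewrite mulr0 addr0 eqxx.
Qed.

End Invariants.

(** * The transport theorem *)

Section Caratheodory.
Variable R : realType.
Implicit Types (f r phi : R -> R) (t l : R).

(** With the slope filled in by [l] at [t], increments become products, and slopes of composites
    multiply without a case distinction for vanishing increments. *)
Lemma is_derive_caratheodory f t l : is_derive t (1 : R) f l ->
  exists2 phi, (forall s, f s - f t = phi s * (s - t))
    & phi s @[s --> t] --> l.
Proof.
move=> [df Dl]; exists (fun s => if s == t then l else (f s - f t) / (s - t)).
  move=> s; case: eqVneq => [->|st]; first by rewrite !subrr mulr0.
  by rewrite divfK// subr_eq0.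
have /cvgrPdist_lt H : h^-1 *: (f (h *: (1 : R) + t) - f t) @[h --> 0^'] --> l.
  by rewrite -Dl; exact: df.
apply/cvgrPdist_lt => e e0; have [d /= d0 dH] := H e e0.
exists d => //= s; case: eqVneq => [_ _|st sd]; first by rewrite subrr normr0.
have := dH (s - t); rewrite /= sub0r normrN distrC subr_eq0 => /(_ sd st).
by rewrite [_ *: (1 : R)]mulr1 subrK [_^-1 *: _]mulrC.
Qed.

Lemma caratheodory_is_derive f phi t l :
  (\forall s \near t, f s - f t = phi s * (s - t)) ->
  phi s @[s --> t] --> l -> is_derive t (1 : R) f l.
Proof.
move=> [d /= d0 dE] /cvgrPdist_lt phil.
have H : h^-1 *: (f (h *: (1 : R) + t) - f t) @[h --> 0^'] --> l.
  apply/cvgrPdist_lt => e e0; have [d' /= d'0 dH] := phil e e0.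
  exists (Num.min d d'); first by rewrite /= lt_min d0.
  move=> h /=; rewrite sub0r normrN lt_min => /andP[hd hd'] h0.
  rewrite [h *: (1 : R)]mulr1 (dE (h + t)) /=; last first.
    by rewrite opprD addrCA subrr addr0 normrN.
  rewrite addrK [_^-1 *: _]mulrC mulfK//; apply: dH => /=.
  by rewrite opprD addrCA subrr addr0 normrN.
apply: DeriveDef; first by apply/cvg_ex; exists l.
exact: cvg_lim H.
Qed.

Lemma cvg_is_derive f t l :
  h^-1 *: (f (h + t) - f t) @[h --> 0^'] --> l -> is_derive t (1 : R) f l.
Proof.
move=> fl; have fl' : h^-1 *: (f (h *: (1 : R) + t) - f t) @[h --> 0^'] --> l.
  by under eq_fun => h do rewrite [h *: (1 : R)]mulr1.
by apply: DeriveDef; [apply/cvg_ex; exists l|exact: cvg_lim fl'].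
Qed.

Lemma is_derive_continuous f t l : is_derive t (1 : R) f l ->
  {for t, continuous f}.
Proof. by move=> [df _]; apply/differentiable_continuous/derivable1_diffP. Qed.

(** The slope of [N s] between [r t] and [r s] is, by the mean value theorem, a value [g (s, x)]
    with [x] in between, and [(s, x)] tends to [(t, r t)]. It serves both the moving endpoint of an
    integral and the slope of a level curve. *)
Lemma moving_quotient (N : R -> R -> R) (g : R * R -> R) r t :
  (\forall z \near (t, r t), is_derive z.2 (1 : R) (N z.1) (g z)) ->
  {for (t, r t), continuous g} -> {for t, continuous r} ->
  exists2 gam, (forall s, N s (r s) - N s (r t) = gam s * (r s - r t))
    & gam s @[s --> t] --> g (t, r t).
Proof.
move=> dN cg cr.
exists (fun s => if r s == r t then g (t, r t)
                 else (N s (r s) - N s (r t)) / (r s - r t)).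
  move=> s; case: eqVneq => [->|st]; first by rewrite !subrr mulr0.
  by rewrite divfK// subr_eq0.
apply/cvgrPdist_le => e e0.
have : \forall z \near (t, r t), is_derive z.2 (1 : R) (N z.1) (g z) /\
    `|g (t, r t) - g z| <= e.
  near=> z; split; near: z => //.
  by move/cvgrPdist_le : cg; exact.
move=> /nbhs_ballP[d /= d0 dH].
have /cvgrPdist_lt /(_ d d0) crd := cr.
near=> s; case: eqVneq => [_|st]; first by rewrite subrr normr0 ltW.
have sd : `|t - s| < d by near: s; exists d.
have rd : `|r t - r s| < d by near: s.
(* The quotient is symmetric in its two arguments, so the ordered case covers both positions of
   [r s] relative to [r t]. *)
have key (a b : R) : a < b -> `|r t - a| < d -> `|r t - b| < d ->
    `|g (t, r t) - (N s b - N s a) / (b - a)| <= e.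
  move=> ab ra rb.
  have D x : a <= x <= b -> is_derive x (1 : R) (N s) (g (s, x)) /\
      `|g (t, r t) - g (s, x)| <= e.
    move=> /andP[ax xb]; apply: (dH (s, x)); split => //=.
    move: ra rb; rewrite /ball/= !ltr_norml => /andP[? ?] /andP[? ?].
    by apply/andP; split; lra.
  have Doo x : x \in `]a, b[%R -> is_derive x (1 : R) (N s) (g (s, x)).
    by rewrite in_itv/= => /andP[ax xb]; apply: (D _ _).1; rewrite !ltW.
  have [|c cab ->] := MVT ab Doo.
    apply: derivable_within_continuous => x; rewrite in_itv/= => /D[dx _].
    exact: ex_derive.
  rewrite mulfK ?subr_eq0 ?gt_eqF//; apply: (D _ _).2.
  by move: cab; rewrite in_itv/= => /andP[? ?]; rewrite !ltW.
have rtt : `|r t - r t| < d by rewrite subrr normr0.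
have [lt|gt|E] := ltgtP (r t) (r s).
- exact: key.
- by have := key _ _ gt rd rtt; rewrite -[X in X / _]opprB -[X in _ / X]opprB
    mulNr invrN mulrN opprK.
- by rewrite E eqxx in st.
Unshelve. all: by end_near. Qed.

End Caratheodory.

(** * Integrals over segments *)

Section SegmentIntegrals.
Variable R : realType.
Implicit Types (h : R -> R) (a b c x : R).

(** Not oriented: the value is 0 when [b < a], whence the order hypotheses in additivity. *)
Definition sint h a b : R := \int[lebesgue_measure]_(x in `[a, b]) h x.

Lemma continuous_on_segment h a b :
  (forall x, a <= x <= b -> {for x, continuous h}) ->
  {within `[a, b], continuous h}.
Proof.
move=> ch; apply: continuous_in_subspaceT => x; rewrite inE/= in_itv/=.
exact: ch.
Qed.

Lemma segment_integrable h a b :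
  (forall x, a <= x <= b -> {for x, continuous h}) ->
  (@lebesgue_measure R).-integrable `[a, b] (EFin \o h).
Proof.
move=> ch; apply: continuous_compact_integrable; first exact: segment_compact.
exact: continuous_on_segment.
Qed.

Lemma sint_additive h a b c : a <= b -> b <= c ->
  (forall x, a <= x <= c -> {for x, continuous h}) ->
  sint h b c = sint h a c - sint h a b.
Proof.
move=> ab bc ch; have ih := segment_integrable ch.
rewrite /sint (Rintegral_itvB ih) ?bnd_simp// Rintegral_itv_obnd_cbnd//.
apply: integrableS ih => //; apply: subset_itv; by rewrite bnd_simp.
Qed.

Lemma is_derive_sint h a b x : a < x < b ->
  (forall x, a <= x <= b -> {for x, continuous h}) ->
  is_derive x (1 : R) (sint h a) (h x).
Proof.
move=> /andP[ax xb] ch.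
have cx : {for x, continuous h} by apply: ch; rewrite !ltW.
have [dF F'] := continuous_FTC1_closed xb (segment_integrable ch) ax cx.
by apply: DeriveDef; [exact: dF|rewrite -derive1E; exact: F'].
Qed.

Lemma sint_derive (H h : R -> R) a b : a < b ->
  (forall x, a <= x <= b -> is_derive x (1 : R) H (h x)) ->
  (forall x, a <= x <= b -> {for x, continuous h}) ->
  sint h a b = H b - H a.
Proof.
move=> ab dH ch; rewrite /sint /Rintegral.
have cH x : a <= x <= b -> {for x, continuous H}.
  by move=> /dH; exact: is_derive_continuous.
rewrite (@continuous_FTC2 _ h H)//.
- exact: continuous_on_segment.
- split.
  + move=> x; rewrite in_itv/= => /andP[ax xb].
    by have [] := dH x; rewrite ?ltW.
  + by apply: cvg_at_right_filter; apply: cH; rewrite lexx ltW.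
  + by apply: cvg_at_left_filter; apply: cH; rewrite lexx ltW.
- move=> x; rewrite in_itv/= => /andP[ax xb].
  by rewrite derive1E; have [] := dH x; rewrite ?ltW.
Qed.

Lemma sint_eq0 h a b : a < b -> (forall x, a <= x <= b -> h x = 0) ->
  sint h a b = 0.
Proof.
move=> ab h0; transitivity (sint (cst 0) a b).
  by apply: eq_Rintegral => x; rewrite inE/= in_itv/=; exact: h0.
have d0 x : a <= x <= b -> is_derive x (1 : R) (cst 0 : R -> R) (cst 0 x).
  by move=> _; exact: is_derive_cst.
have c0 x : a <= x <= b -> {for x, continuous (cst 0 : R -> R)}.
  by move=> _; exact: cvg_cst.
by rewrite (sint_derive ab d0 c0) subrr.
Qed.

Lemma sint_mean (H h : R -> R) a b : a < b ->
  (forall x, a <= x <= b -> is_derive x (1 : R) H (h x)) ->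
  (forall x, a <= x <= b -> {for x, continuous h}) ->
  exists2 x, a <= x <= b & sint h a b = h x * (b - a).
Proof.
move=> ab dH ch; rewrite (sint_derive ab dH ch).
have Doo x : x \in `]a, b[%R -> is_derive x (1 : R) H (h x).
  by rewrite in_itv/= => /andP[ax xb]; apply: dH; rewrite !ltW.
have [|x xab ->] := MVT ab Doo.
  by apply: continuous_on_segment => x /dH; exact: is_derive_continuous.
by exists x => //; move: xab; rewrite in_itv/= => /andP[? ?]; rewrite !ltW.
Qed.

End SegmentIntegrals.

(** * Differentiation of integrals with moving endpoints *)

Section Leibniz.
Variables (R : realType) (A : set (R * R)) (t1 t2 c d : R).
Hypotheses (oA : open A) (cd : c < d).
Hypothesis box : forall s x, t1 <= s <= t2 -> c <= x <= d -> A (s, x).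
Implicit Types (g v : R * R -> R) (s t x : R).

Lemma slice_continuous g s x : smooth_on A g ->
  t1 <= s <= t2 -> c <= x <= d -> {for x, continuous (fun y => g (s, y))}.
Proof.
move=> sg st xcd; have cg := smooth_on_continuous sg (box st xcd).
exact: continuous_comp (@slice_r_continuous R s x) cg.
Qed.

(** Compactness of the closed box supplies the constant that dominates the time derivative when
    differentiating under the integral sign. *)
Lemma bounded_box g : smooth_on A g ->
  exists2 M, 0 <= M & forall s x, t1 <= s <= t2 -> c <= x <= d -> `|g (s, x)| <= M.
Proof.
move=> sg; set K := [set` `[t1, t2]] `*` [set` `[c, d]] : set (R * R).
have cK : compact K by apply: compact_setX; exact: segment_compact.
have cg : {within K, continuous g}.
  apply: continuous_in_subspaceT => -[s x]; rewrite inE => -[/= sI xI].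
  apply: smooth_on_continuous sg _; apply: box.
    by move: sI; rewrite in_itv.
  by move: xI; rewrite in_itv.
have /compact_bounded [M [Mr MB]] := continuous_compact cg cK.
exists (`|M| + 1) => [|s x sI xI]; first by rewrite addr_ge0.
apply: (MB (`|M| + 1)); first by rewrite (le_lt_trans (ler_norm _))// ltrDl.
by exists (s, x) => //; split; rewrite /= in_itv.
Qed.

Lemma is_derive_dt_sint g t x : smooth_on A g ->
  t1 < t < t2 -> c <= x <= d ->
  is_derive t (1 : R) (fun s => sint (fun y => g (s, y)) c x)
    (sint (fun y => dt g (t, y)) c x).
Proof.
move=> sg tI /andP[cx xd].
have xcd y : c <= y <= x -> c <= y <= d.
  by move=> /andP[-> yx]; rewrite (le_trans yx).
have [M M0 HM] := bounded_box (smooth_on_dt sg).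
have Itv s : `]t1, t2[%classic s -> t1 <= s <= t2.
  by rewrite /= in_itv/= => /andP[? ?]; rewrite !ltW.
have Itx y : `[c, x]%classic y -> c <= y <= d.
  by rewrite /= in_itv/=; exact: xcd.
have dg s y : t1 <= s <= t2 -> c <= y <= d -> differentiable g (s, y).
  by move=> sI yI; exact: smooth_on_differentiable sg (box sI yI).
have Ia : `]t1, t2[%classic t by rewrite /= in_itv.
have intf s : `]t1, t2[%classic s ->
    (@lebesgue_measure R).-integrable `[c, x] (EFin \o (fun y => g (s, y))).
  move=> /Itv sI; apply: segment_integrable => y /xcd.
  exact: slice_continuous.
have derf s y : `]t1, t2[%classic s -> `[c, x]%classic y ->
    derivable (fun s => g (s, y)) s 1.
  move=> /Itv sI /Itx yI.
  by have [] := is_derive_dt (dg _ _ sI yI).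
have intM : (@lebesgue_measure R).-integrable `[c, x] (EFin \o (cst M)).
  by apply: segment_integrable => y _; exact: cvg_cst.
have GM s y : `]t1, t2[%classic s -> `[c, x]%classic y ->
    `|partial1of2 (fun s y => g (s, y)) s y| <= cst M y.
  move=> /Itv sI /Itx yI; rewrite /partial1of2 derive1_dt; exact: HM.
have H := @cvg_differentiation_under_integral R _ _ (@lebesgue_measure R)
  (fun s y => g (s, y)) _ (measurable_itv _) t t1 t2 Ia intf derf _
  (fun=> M0) intM GM.
have E : \int[lebesgue_measure]_(y in `[c, x])
    partial1of2 (fun s y => g (s, y)) t y = sint (fun y => dt g (t, y)) c x.
  by apply: eq_Rintegral => y _; rewrite /partial1of2 derive1_dt.
by rewrite -E; exact: cvg_is_derive H.
Qed.

Lemma is_derive_sint_moving g t (r : R -> R) r' : smooth_on A g ->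
  t1 < t < t2 -> c < r t < d -> is_derive t (1 : R) r r' ->
  is_derive t (1 : R) (fun s => sint (fun y => g (s, y)) c (r s))
    (sint (fun y => dt g (t, y)) c (r t) + g (t, r t) * r').
Proof.
move=> sg tI rI dr.
have tI' : t1 <= t <= t2 by move: tI => /andP[? ?]; rewrite !ltW.
have rI' : c <= r t <= d by move: rI => /andP[? ?]; rewrite !ltW.
have [phi phiE phil] := is_derive_caratheodory dr.
have [psi psiE psil] := is_derive_caratheodory (is_derive_dt_sint sg tI rI').
have nI : \forall z \near (t, r t), t1 < z.1 < t2 /\ c < z.2 < d.
  move: tI rI => /andP[t1t tt2] /andP[cr rd].
  exists ([set` `]t1, t2[], [set` `]c, d[]) => /=.
    by split; apply: near_in_itvoo; rewrite in_itv/=; apply/andP.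
  by move=> z /= []; rewrite !in_itv.
have [] := @moving_quotient R (fun s x => sint (fun y => g (s, y)) c x) g r t.
- apply: filterS nI => -[s x] /= [sI xI]; apply: (is_derive_sint xI) => y.
  by apply: slice_continuous => //; move: sI => /andP[? ?]; rewrite !ltW.
- by apply: smooth_on_continuous sg _; exact: box.
- exact: is_derive_continuous dr.
(* With I(s, x) the integral from [c] to [x] at time s, the increment is I(s, r s) - I(s, r t), of
   slope [gam s * phi s], plus I(s, r t) - I(t, r t), of slope [psi s]. *)
move=> gam gamE gaml; apply: (@caratheodory_is_derive _ _
  (fun s => psi s + gam s * phi s)).
  near=> s; rewrite mulrDl -psiE -mulrA -phiE -gamE.
  by rewrite [RHS]addrC subrKA.
exact: cvgD psil (cvgM gaml phil).
Unshelve. all: by end_near. Qed.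

Lemma sint_dr g s a b : smooth_on A g -> t1 <= s <= t2 ->
  c <= a -> a < b -> b <= d ->
  sint (fun y => dr g (s, y)) a b = g (s, b) - g (s, a).
Proof.
move=> sg sI ca ab bd.
have cyd y : a <= y <= b -> c <= y <= d.
  by move=> /andP[ay yb]; rewrite (le_trans ca ay) (le_trans yb).
apply: (sint_derive (H := fun y => g (s, y)) ab) => y /cyd yI.
  by apply: is_derive_dr; apply: smooth_on_differentiable sg _; exact: box.
by apply: slice_continuous => //; exact: smooth_on_dr.
Qed.

Lemma sintD (h1 h2 : R -> R) a b :
  (forall x, a <= x <= b -> {for x, continuous h1}) ->
  (forall x, a <= x <= b -> {for x, continuous h2}) ->
  sint (fun x => h1 x + h2 x) a b = sint h1 a b + sint h2 a b.
Proof.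
by move=> c1 c2; rewrite /sint RintegralD//; exact: segment_integrable.
Qed.

(** For an endpoint moving with [v], the boundary term there is the upper boundary value of the
    integral of [dr] of [v g]. What remains is the flux through the fixed base point [c], which
    cancels in the difference of two such integrals. *)
Lemma is_derive_sint_flow g v t (r : R -> R) : smooth_on A g ->
  smooth_on A v -> t1 < t < t2 -> c < r t < d ->
  is_derive t (1 : R) r (v (t, r t)) ->
  is_derive t (1 : R) (fun s => sint (fun y => g (s, y)) c (r s))
    (sint (fun y => balance v g (t, y)) c (r t) + v (t, c) * g (t, c)).
Proof.
move=> sg sv tI rI dr'.
apply: is_derive_eq; first exact: is_derive_sint_moving dr'.
have tI' : t1 <= t <= t2 by move: tI => /andP[? ?]; rewrite !ltW.
have /andP[cr rd] := rI.
have cyd y : c <= y <= r t -> c <= y <= d.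
  by move=> /andP[-> yb]; rewrite (le_trans yb)// ltW.
have svg := smooth_onM oA sv sg.
rewrite /balance sintD => [|y /cyd yI|y /cyd yI].
- rewrite (sint_dr svg tI')// ?ltW// -addrA subrK; congr (_ + _).
  exact: mulrC.
- by apply: slice_continuous => //; exact: smooth_on_dt.
- by apply: slice_continuous => //; exact: smooth_on_dr.
Qed.

Lemma smooth_on_balance g v : smooth_on A g -> smooth_on A v ->
  smooth_on A (balance v g).
Proof.
move=> sg sv; apply: smooth_onD => //; first exact: smooth_on_dt.
by apply: smooth_on_dr; exact: smooth_onM.
Qed.

Lemma is_derive_sint_transported g v t (r1 r2 : R -> R) : smooth_on A g ->
  smooth_on A v -> t1 < t < t2 ->
  c < r1 t -> r1 t < r2 t -> r2 t < d ->
  is_derive t (1 : R) r1 (v (t, r1 t)) ->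
  is_derive t (1 : R) r2 (v (t, r2 t)) ->
  is_derive t (1 : R) (fun s => sint (fun y => g (s, y)) (r1 s) (r2 s))
    (sint (fun y => balance v g (t, y)) (r1 t) (r2 t)).
Proof.
move=> sg sv tI cr1 r12 r2d d1 d2.
have tI' : t1 <= t <= t2 by move: tI => /andP[? ?]; rewrite !ltW.
have r1I : c < r1 t < d by rewrite cr1 (lt_trans r12).
have r2I : c < r2 t < d by rewrite r2d (lt_trans cr1).
have D1 := is_derive_sint_flow sg sv tI r1I d1.
have D2 := is_derive_sint_flow sg sv tI r2I d2.
apply: (@near_eq_is_derive _ _ _ (fun s =>
  sint (fun y => g (s, y)) c (r2 s) - sint (fun y => g (s, y)) c (r1 s))).
  (* As [sint] is not oriented, splitting at [c] needs [c <= r1 s <= r2 s]; continuity of the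
     endpoints gives this for [s] near [t]. *)
  have /andP[t1t tt2] := tI.
  have c1 := is_derive_continuous d1; have c2 := is_derive_continuous d2.
  near=> s; rewrite -(@sint_additive _ _ c)// => [||y /andP[cy yr]].
  - by rewrite ltW//; near: s; exact: (cvgr_gt (r1 t)).
  - rewrite -subr_ge0 ltW//; near: s; apply: (cvgr_gt (r2 t - r1 t)).
      exact: cvgB.
    by rewrite subr_gt0.
  - apply: slice_continuous => //.
      apply/andP; split; rewrite ltW//; near: s.
        exact: (cvgr_gt t).
      exact: (cvgr_lt t).
    rewrite cy (le_trans yr)// ltW//.
    by near: s; exact: (cvgr_lt (r2 t)).
apply: (is_derive_eq (@is_deriveB _ _ _ _ _ _ _ _ _ D2 D1)).
rewrite opprD addrACA subrr addr0 -(@sint_additive _ _ c) ?ltW// => y /andP[cy yr].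
apply: slice_continuous => //; first exact: smooth_on_balance.
by rewrite cy (le_trans yr)// ltW.
Unshelve. all: by end_near. Qed.

End Leibniz.

(** * Particle paths *)

Section LevelCurves.
Variables (R : realType) (t1 t2 c d : R) (N : R -> R -> R) (m v : R * R -> R).
Hypothesis Nx : forall s x, t1 < s < t2 -> c < x < d ->
  is_derive x (1 : R) (N s) (m (s, x)).
Hypothesis Nt : forall s x, t1 < s < t2 -> c < x < d ->
  is_derive s (1 : R) (N ^~ x) (- (v (s, x) * m (s, x))).
Hypothesis m_gt0 : forall s x, t1 < s < t2 -> c < x < d -> 0 < m (s, x).
Hypothesis m_cont : forall s x, t1 < s < t2 -> c < x < d ->
  {for (s, x), continuous m}.

Lemma level_incr s x y : t1 < s < t2 -> c < x -> x < y -> y < d ->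
  N s x < N s y.
Proof.
move=> sI cx xy yd; rewrite -subr_gt0.
have I z : x <= z <= y -> c < z < d.
  by move=> /andP[xz zy]; rewrite (lt_le_trans cx)// (le_lt_trans zy).
have Doo z : z \in `]x, y[%R -> is_derive z (1 : R) (N s) (m (s, z)).
  by rewrite in_itv/= => /andP[xz zy]; apply: Nx => //; apply: I; rewrite !ltW.
have [|z zxy ->] := MVT xy Doo.
  apply: continuous_on_segment => z /I zI.
  exact: is_derive_continuous (Nx sI zI).
rewrite mulr_gt0 ?subr_gt0// m_gt0//; apply: I.
by move: zxy; rewrite in_itv/= => /andP[? ?]; rewrite !ltW.
Qed.

Lemma level_lt s x y : t1 < s < t2 -> c < x < d -> c < y < d ->
  N s x < N s y -> x < y.
Proof.
move=> sI /andP[cx xd] /andP[cy yd]; apply: contraTT; rewrite -!leNgt.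
by rewrite le_eqVlt => /predU1P[->//|yx]; rewrite ltW// level_incr.
Qed.

(* Along a level curve [0 = N_t + N_x r'], that is [r' = v]. *)
Lemma is_derive_level (r : R -> R) k u1 u2 t : t1 <= u1 -> u2 <= t2 ->
  (forall s, u1 < s < u2 -> c < r s < d /\ N s (r s) = k) ->
  u1 < t < u2 -> is_derive t (1 : R) r (v (t, r t)).
Proof.
move=> tu ut rP tu12; have /andP[u1t tu2] := tu12.
have uI s : u1 < s < u2 -> t1 < s < t2.
  by move=> /andP[us su]; rewrite (le_lt_trans tu)// (lt_le_trans su).
have tI := uI _ tu12.
have [rI Nk] := rP _ tu12; have /andP[cr rd] := rI.
have near_u : \forall s \near t, u1 < s < u2.
  near=> s; apply/andP; split; near: s; [exact: lt_nbhsr|exact: lt_nbhsl].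
have cNt x : c < x < d -> {for t, continuous (N ^~ x)}.
  by move=> xI; exact: is_derive_continuous (Nt tI xI).
have cr_t : {for t, continuous r}.
  apply/cvgrPdist_lt => e e0.
  (* The halves keep [r t - e'] and [r t + e'] strictly inside []c, d[]. At these fixed places [N t]
     lies strictly on either side of [k]; so does [N s] for [s] near [t], and monotonicity traps
     [r s] between them. *)
  pose e' := Num.min e (Num.min ((r t - c) / 2) ((d - r t) / 2)).
  have e'0 : 0 < e' by rewrite !lt_min e0 !divr_gt0// subr_gt0.
  have [e'e e'c e'd] : [/\ e' <= e, e' <= (r t - c) / 2 & e' <= (d - r t) / 2].
    by split; rewrite /e' !ge_min lexx ?orbT.
  have lo : c < r t - e' < d by apply/andP; split; lra.
  have hi : c < r t + e' < d by apply/andP; split; lra.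
  have Nlo : N t (r t - e') < k.
    by rewrite -Nk; apply: level_incr => //; lra.
  have Nhi : k < N t (r t + e').
    by rewrite -Nk; apply: level_incr => //; lra.
  near=> s.
  have su : u1 < s < u2 by near: s.
  have [rsI Nsk] := rP _ su.
  have Nlos : N s (r t - e') < N s (r s).
    by rewrite Nsk; near: s; apply: (cvgr_lt (N t (r t - e'))) => //; exact: cNt.
  have Nhis : N s (r s) < N s (r t + e').
    by rewrite Nsk; near: s; apply: (cvgr_gt (N t (r t + e'))) => //; exact: cNt.
  have := level_lt (uI _ su) lo rsI Nlos; have := level_lt (uI _ su) rsI hi Nhis.
  by move=> ? ?; rewrite ltr_norml; apply/andP; split; lra.
have [||//|gam gamE gaml] := @moving_quotient R N m r t.
- have : \forall z \near (t, r t), t1 < z.1 < t2 /\ c < z.2 < d.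
    exists ([set` `]t1, t2[], [set` `]c, d[]) => /=.
      by split; apply: near_in_itvoo; rewrite in_itv.
    by move=> z /= []; rewrite !in_itv.
  by apply: filterS => -[s x] /= [sI xI]; exact: Nx.
- exact: m_cont.
have [psi psiE psil] := is_derive_caratheodory (Nt tI rI).
have m0 := m_gt0 tI rI.
(* Both [N s (r s)] and [N t (r t)] equal [k], so [gam s * (r s - r t)] is [N t (r t) - N s (r t)],
   that is [- psi s * (s - t)]. *)
apply: (@caratheodory_is_derive _ _ (fun s => - psi s * (gam s)^-1)).
  near=> s; have su : u1 < s < u2 by near: s.
  have g0 : gam s != 0 by near: s; apply: cvgr_neq0 gaml _; rewrite gt_eqF.
  have [_ Nsk] := rP _ su.
  have := gamE s; rewrite Nsk -Nk -[LHS]opprB psiE => E.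
  by rewrite mulrAC mulNr E mulrAC mulfV// mul1r.
have -> : v (t, r t) = - - (v (t, r t) * m (t, r t)) * (m (t, r t))^-1.
  by rewrite opprK mulfK// gt_eqF.
apply: cvgM; first exact: cvgN.
by apply: cvgV => //; rewrite gt_eqF.
Unshelve. all: by end_near. Qed.

(** Two fixed places around [a] bracket the level at time [t0], hence at nearby times, and the
    intermediate value theorem finds the level between them. *)
Lemma level_curve t0 a : t1 < t0 < t2 -> c < a < d ->
  exists2 e, 0 < e & exists2 r : R -> R, r t0 = a &
    forall s, t0 - e < s < t0 + e ->
      [/\ t1 < s < t2, c < r s < d & N s (r s) = N t0 a].
Proof.
move=> t0I aI; have /andP[ca ad] := aI; have /andP[t1t0 t0t2] := t0I.
pose lo := (c + a) / 2; pose hi := (a + d) / 2.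
have [clo loa] : c < lo /\ lo < a by rewrite /lo; split; lra.
have [ahi hid] : a < hi /\ hi < d by rewrite /hi; split; lra.
have loI : c < lo < d by rewrite clo (lt_trans loa).
have hiI : c < hi < d by rewrite hid (lt_trans ca).
have : \forall s \near t0, t1 < s < t2 /\ N s lo < N t0 a < N s hi.
  near=> s; split.
    by apply/andP; split; near: s; [exact: lt_nbhsr|exact: lt_nbhsl].
  apply/andP; split; near: s.
    apply: (cvgr_lt (N t0 lo)); last exact: level_incr.
    exact: is_derive_continuous (Nt t0I loI).
  apply: (cvgr_gt (N t0 hi)); last exact: level_incr.
  exact: is_derive_continuous (Nt t0I hiI).
move=> [e /= e0 eP]; exists e => //.
(* The first clause makes the curve obtained by choice pass through [a]; outside the time window the
   value is a mere default. *)
have ex s : exists x, (s = t0 -> x = a) /\ (t0 - e < s < t0 + e ->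
    c < x < d /\ N s x = N t0 a).
  have [->|st0] := eqVneq s t0; first by exists a.
  case: (pselect (t0 - e < s < t0 + e)) => [sI|nsI]; last first.
    by exists a; split=> // E; rewrite E eqxx in st0.
  have [sI' /andP[Nlo Nhi]] : t1 < s < t2 /\ N s lo < N t0 a < N s hi.
    by apply: eP; rewrite /= distrC ltr_distl.
  have lohi : lo <= hi by rewrite ltW// (lt_trans loa).
  have cN : {within `[lo, hi], continuous (N s)}.
    apply: continuous_on_segment => x /andP[lx xh].
    apply: is_derive_continuous (Nx sI' _).
    by rewrite (lt_le_trans clo)// (le_lt_trans xh).
  have [|x] := IVT (v := N t0 a) lohi cN.
    by rewrite ge_min (ltW Nlo) le_max (ltW Nhi) orbT.
  rewrite in_itv/= => /andP[lx xh] Nx0; exists x; split=> [E|_].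
    by rewrite E eqxx in st0.
  by split=> //; rewrite (lt_le_trans clo)// (le_lt_trans xh).
have [r rP] := choice ex; exists r; first exact: (rP _).1.
move=> s sI; have [_ /(_ sI)[rI Nr]] := rP s; split=> //.
by apply: (eP s _).1; rewrite /= distrC ltr_distl.
Unshelve. all: by end_near. Qed.

End LevelCurves.

(** * The stream function *)

Section StreamFunction.
Variables (R : realType) (A : set (R * R)) (t1 t2 c d : R).
Variables (m v : R * R -> R).
Hypotheses (oA : open A) (cd : c < d).
Hypothesis box : forall s x, t1 <= s <= t2 -> c <= x <= d -> A (s, x).
Hypotheses (sm : smooth_on A m) (sv : smooth_on A v).
Hypothesis m_gt0 : forall z, A z -> 0 < m z.
Hypothesis mv : forall z, A z -> balance v m z = 0.

(* The mass between [c] and [x], corrected for the flux through [c]. *)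
Let N s x := sint (fun y => m (s, y)) c x
  - sint (fun s => v (s, c) * m (s, c)) t1 s.

Let Itv (a b s : R) : a < s < b -> a <= s <= b.
Proof. by move=> /andP[? ?]; rewrite !ltW. Qed.

Lemma stream_x s x : t1 < s < t2 -> c < x < d ->
  is_derive x (1 : R) (N s) (m (s, x)).
Proof.
move=> sI xI; have D : is_derive x (1 : R) (sint (fun y => m (s, y)) c) (m (s, x)).
  by apply: (is_derive_sint xI) => y; apply: slice_continuous box _ _ _ _ _ => //; exact: Itv.
apply: (is_derive_eq (@is_deriveB _ _ _ _ _ _ _ _ _ D (is_derive_cst _ _ _))).
by rewrite subr0.
Qed.

(** By [mv], the integral of [dt m] from [c] to [x] is the flux at [c] minus the flux at [x]; the
    correction term in [N] removes the flux at [c]. *)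
Lemma stream_t s x : t1 < s < t2 -> c < x < d ->
  is_derive s (1 : R) (N ^~ x) (- (v (s, x) * m (s, x))).
Proof.
move=> sI xI; have /andP[cx xd] := xI.
have svm := smooth_onM oA sv sm.
have D1 := is_derive_dt_sint box sm sI (Itv xI).
have D2 : is_derive s (1 : R) (sint (fun s => v (s, c) * m (s, c)) t1)
    (v (s, c) * m (s, c)).
  apply: (is_derive_sint sI) => y yI.
  have cI : c <= c <= d by rewrite lexx ltW.
  have := smooth_on_continuous svm (box yI cI).
  exact: continuous_comp (@slice_t_continuous R y c).
apply: (is_derive_eq (@is_deriveB _ _ _ _ _ _ _ _ _ D1 D2)).
have E := sint_dr box svm (Itv sI) (lexx c) cx (ltW xd).
have xI' y : c <= y <= x -> c <= y <= d.
  by move=> /andP[-> yx]; rewrite (le_trans yx)// ltW.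
have : sint (fun y => dt m (s, y) + dr (fun z => v z * m z) (s, y)) c x = 0.
  by apply: sint_eq0 => // y /xI' yI; apply: mv; apply: box => //; exact: Itv.
rewrite (@sintD R) => [|y /xI' yI|y /xI' yI].
- rewrite E /= => /eqP; rewrite addr_eq0 => /eqP ->.
  by rewrite opprB addrAC subrr sub0r.
- by apply: (slice_continuous box) => //; [exact: smooth_on_dt|exact: Itv].
- by apply: (slice_continuous box) => //; [exact: smooth_on_dr|exact: Itv].
Qed.

(* The fluid particles move along the level curves of the stream function. *)
Lemma particle_path t0 a : t1 < t0 < t2 -> c < a < d ->
  exists2 e, 0 < e & exists2 r : R -> R, r t0 = a &
    forall s, t0 - e < s < t0 + e ->
      [/\ t1 < s < t2, c < r s < d & is_derive s (1 : R) r (v (s, r s))].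
Proof.
move=> t0I aI.
have mb s x : t1 < s < t2 -> c < x < d -> 0 < m (s, x).
  by move=> /Itv sI /Itv xI; exact/m_gt0/box.
have mc s x : t1 < s < t2 -> c < x < d -> {for (s, x), continuous m}.
  by move=> /Itv sI /Itv xI; exact: smooth_on_continuous sm (box sI xI).
have [e e0 [r r0 rP]] := level_curve stream_x stream_t mb t0I aI.
(* The time window of the curve, cut down to []t1, t2[] as [is_derive_level] requires. *)
pose u1 := Num.max t1 (t0 - e); pose u2 := Num.min t2 (t0 + e).
exists e => //; exists r => // s sI; have [sI' rI Nr] := rP _ sI; split=> //.
apply: (is_derive_level stream_x stream_t mb mc (k := N t0 a) (u1 := u1) (u2 := u2)).
- by rewrite /u1 le_max lexx.
- by rewrite /u2 ge_min lexx.
- move=> y; rewrite /u1 /u2 gt_max lt_min => /andP[/andP[_ y1] /andP[_ y2]].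
  by have [|_ ? ?] := rP y; rewrite ?y1.
- move: sI sI' => /andP[? ?] /andP[? ?].
  by rewrite /u1 /u2 gt_max lt_min; apply/andP; split; apply/andP; split.
Qed.

End StreamFunction.

Section Tube.
Variable R : realType.

(** Compactness of the segment makes the width of the neighbourhoods uniform. Used around a whole
    fluid segment and, with [a = b], around a single point. *)
Lemma segment_tube (A : set (R * R)) (t a b : R) : open A -> a <= b ->
  (forall x, a <= x <= b -> A (t, x)) ->
  exists2 e, 0 < e & forall s x, t - e <= s <= t + e ->
    a - e <= x <= b + e -> A (s, x).
Proof.
move=> oA ab Aab.
have /compact_near_coveringP cov := @segment_compact R a b.
have /cov : forall x, `[a, b]%classic x -> \forall x' \near x & e \near (0 : R)^'+,
    forall s y, `|s - t| <= e -> `|y - x'| <= e -> A (s, y).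
  move=> x; rewrite /= in_itv/= => xab.
  have /nbhs_ballP[d /= d0 dA] := open_nbhs_nbhs (conj oA (Aab x xab)).
  (* One half of [d] for the distance from [x] to [x'], the other for the deviation [e] from
     [x']. *)
  exists (ball x (d / 2), [set e | e < d / 2]) => /=.
    split; first by apply: nbhsx_ballx; rewrite divr_gt0.
    by apply: nbhs_right_lt; rewrite divr_gt0.
  move=> [x' e] /= [xx' ed] s y st yx'; apply: dA; split => /=.
    rewrite /ball/= distrC (le_lt_trans st)// (lt_trans ed)//.
    by rewrite ltr_pdivrMr// ltr_pMr// ltr1n.
  rewrite /ball/= distrC (le_lt_trans (ler_distD x' _ _))// (splitr d).
  by rewrite ltr_leD ?(le_lt_trans yx')// ?ltW// distrC.
move=> cov'.
have [e [/= e0 eP]] := filter_ex (filterI (nbhs_right_gt (0 : R)) cov').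
exists e => // s x sI /andP[ax xb].
have sI' : `|s - t| <= e by rewrite ler_distl.
(* The point of [[a, b]] nearest to [x]. *)
pose x' := Num.max a (Num.min b x).
have x'I : `[a, b]%classic x'.
  by rewrite /= in_itv/= le_max lexx/= ge_max ab ge_min lexx.
apply: (eP x' x'I) => //; rewrite ler_distl /x'.
case: (leP b x) => bx; [case: (leP a b)|case: (leP a x)] => ?.
all: by apply/andP; split; lra.
Qed.

End Tube.

(** * Integral invariants *)

Section IntegralInvariants.
Variables (R : realType) (n : nat) (P : set (R * R)) (p : R * R -> R).
Hypotheses (n_gt1 : (1 < n)%N) (oP : open P) (sp : smooth_on P p).
Variables (k : nat) (Om : set (jet R k)) (J : jet R k -> R).
Hypotheses (oOm : open Om) (sJ : smooth_on Om J).

Section Solution.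
Variables (u : 'I_3 -> R -> R -> R) (W : set (R * R)).
Hypothesis sol : euler_solution n p P u W.

Let W' := jet_preimage u W Om.
Let f z := J (jet_field u k z).
Let q z := mass n u z * f z.
Let v := velocity u.

Let oW' : open W'.
Proof.
exact (open_jet_preimage (solution_open sol) (solution_smooth sol) oOm).
Qed.

Let W'W : W' `<=` W. Proof. by move=> z []. Qed.

Let sm : smooth_on W' (mass n u).
Proof. exact: smooth_on_sub W'W (smooth_on_mass sol). Qed.

Let sv : smooth_on W' v.
Proof. exact: smooth_on_sub W'W (solution_smooth sol iU). Qed.

Let sf : smooth_on W' f.
Proof. exact (smooth_on_invariant oOm sJ sol). Qed.

Let sq : smooth_on W' q.
Proof. exact: smooth_onM. Qed.

Lemma balance_invariant z : W' z ->
  balance v q z = mass n u z * material v f z.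
Proof.
move=> W'z; apply: balance_mul.
- exact: smooth_on_differentiable sv W'z.
- exact: smooth_on_differentiable sm W'z.
- exact: smooth_on_differentiable sf W'z.
- by apply: (mass_balance n_gt1 sol); exact: W'W.
Qed.

(** Each time [t] gets its own closed tube in [W'] around the fluid segment, since the boxes of the
    transport theorem need not exist uniformly over []t1, t2[]. *)
Lemma is_derive_transported t1 t2 (r1 r2 : R -> R) t :
  transported (u iU) t1 t2 r1 r2 ->
  (forall t r, t1 < t < t2 -> r1 t <= r <= r2 t ->
     W (t, r) /\ Om (jet_of k u t r)) ->
  t1 < t < t2 ->
  is_derive t (1 : R) (fun s => \int[lebesgue_measure]_(r in `[r1 s, r2 s])
      (jdens (jet_of k u s r) * J (jet_of k u s r) * r ^+ n.-1))
    (sint (fun r => balance v q (t, r)) (r1 t) (r2 t)).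
Proof.
move=> tr dom tI; have [r12 d1 d2] := tr t tI.
have W'P s r : t1 < s < t2 -> r1 s <= r <= r2 s -> W' (s, r).
  move=> sI rI; have [Ws Oms] := dom s r sI rI; split => //=.
  by rewrite -(jet_fieldE u (solution_open sol) k Ws).
have [e e0 eP] := segment_tube oW' (ltW r12) (fun r rI => W'P t r tI rI).
have cd : r1 t - e < r2 t + e by lra.
have tI' : t - e < t < t + e by apply/andP; split; lra.
have D := is_derive_sint_transported oW' eP sq sv tI' _ r12 _ d1 d2.
apply: near_eq_is_derive (D _ _); [|lra|lra].
have /andP[t1t tt2] := tI; near=> s.
apply: eq_Rintegral => r; rewrite inE/= in_itv/= => rI.
have sI : t1 < s < t2.
  by apply/andP; split; near: s; [exact: lt_nbhsr|exact: lt_nbhsl].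
have [Ws Oms] := dom s r sI rI.
rewrite (@jet_fieldE _ u _ (solution_open sol) k _ _ Ws).
rewrite /jdens jcoord_jet_field// /q /f /mass /=.
by rewrite [RHS]mulrC mulrA.
Unshelve. all: by end_near. Qed.

(* If the material derivative did not vanish at a point, it would not vanish
   on a small cylinder around it; but every fluid segment in that cylinder
   contains a zero of it, by the mean value theorem. *)
Lemma material_eq0 z : W' z ->
  (forall (t1 t2 : R) (r1 r2 : R -> R),
      transported (u iU) t1 t2 r1 r2 ->
      (forall t r, t1 < t < t2 -> r1 t <= r <= r2 t -> W' (t, r)) ->
      forall t, t1 < t < t2 ->
        sint (fun r => balance v q (t, r)) (r1 t) (r2 t) = 0) ->
  material v f z = 0.
Proof.
case: z => t r W'z int0; apply/eqP; apply: contrapT => /negP Kz.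
pose h := balance v q.
have sh : smooth_on W' h by exact: smooth_on_balance.
pose A := W' `&` [set z | h z != 0].
have oA : open A.
  rewrite openE => y [W'y hy]; apply: filterI.
    exact: open_nbhs_nbhs.
  exact: cvgr_neq0 (smooth_on_continuous sh W'y) hy.
have Az : A (t, r).
  split=> //=; rewrite /h balance_invariant// mulf_neq0//.
  by rewrite gt_eqF// (mass_gt0 sol)//; exact: W'W.
have [|e e0 eP] := @segment_tube R A t r r oA (lexx r).
  by move=> x; rewrite -eq_le => /eqP <-.
have AW' : A `<=` W' by move=> y [].
pose c := r - e; pose d := r + e; pose t1 := t - e; pose t2 := t + e.
have cd : c < d by rewrite /c /d; lra.
have tI : t1 < t < t2 by rewrite /t1 /t2; apply/andP; split; lra.
have mA y : A y -> 0 < mass n u y.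
  by move=> /AW' /W'W; exact: (mass_gt0 sol).
have bA y : A y -> balance v (mass n u) y = 0.
  by move=> /AW' /W'W; exact: (mass_balance n_gt1 sol).
have smA := smooth_on_sub AW' sm; have svA := smooth_on_sub AW' sv.
(* Halfway between the centre and the walls, so that both paths start strictly inside the box and in
   the right order. *)
pose a := r - e / 2; pose b := r + e / 2.
have aI : c < a < d by rewrite /c /a /d; apply/andP; split; lra.
have bI : c < b < d by rewrite /c /b /d; apply/andP; split; lra.
have ab : a < b by rewrite /a /b; lra.
have [e1 e10 [r1 r1t r1P]] := particle_path oA cd eP smA svA mA bA tI aI.
have [e2 e20 [r2 r2t r2P]] := particle_path oA cd eP smA svA mA bA tI bI.
have c1 : {for t, continuous r1}.
  have [|_ _] := r1P t; first by apply/andP; split; lra.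
  exact: is_derive_continuous.
have c2 : {for t, continuous r2}.
  have [|_ _] := r2P t; first by apply/andP; split; lra.
  exact: is_derive_continuous.
(* Continuity at [t] keeps the two paths on either side of the midpoint of their starting places, so
   they bound a nondegenerate domain for a short time. *)
have : \forall s \near t, r1 s < (a + b) / 2 < r2 s.
  near=> s; apply/andP; split; near: s.
    by apply: (cvgr_lt (r1 t)) => //; rewrite r1t; lra.
  by apply: (cvgr_gt (r2 t)) => //; rewrite r2t; lra.
move=> [e3 /= e30 e3P].
pose e' := Num.min e1 (Num.min e2 e3).
have e'0 : 0 < e' by rewrite !lt_min e10 e20.
have sP s : t - e' < s < t + e' -> [/\ t - e1 < s < t + e1,
    t - e2 < s < t + e2 & r1 s < r2 s].
  move=> /andP[s1 s2].
  have [E1 E2 E3] : [/\ e' <= e1, e' <= e2 & e' <= e3].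
    by rewrite /e' !ge_min !lexx !orbT.
  split; [by apply/andP; split; lra|by apply/andP; split; lra|].
  have /andP[] : r1 s < (a + b) / 2 < r2 s.
    by apply: e3P; rewrite /= distrC ltr_distl; apply/andP; split; lra.
  exact: lt_trans.
have tr : transported (u iU) (t - e') (t + e') r1 r2.
  by move=> s /sP[/r1P[_ _ D1] /r2P[_ _ D2] lt].
have inA s x : t - e' < s < t + e' -> r1 s <= x <= r2 s -> A (s, x).
  move=> /sP[/r1P[sI /andP[cr1 _] _] /r2P[_ /andP[_ r2d] _] _] /andP[rx xr].
  apply: eP.
    by move: sI; rewrite /t1 /t2 => /andP[? ?]; rewrite !ltW.
  by apply/andP; split; rewrite ltW// ?(lt_le_trans cr1)// ?(le_lt_trans xr).
have tI' : t - e' < t < t + e' by apply/andP; split; lra.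
have := int0 _ _ _ _ tr (fun s x sI xI => AW' _ (inA s x sI xI)) t tI'.
have [_ _ r12] := sP t tI'.
have ch x : c <= x <= d -> {for x, continuous (fun y => h (t, y))}.
  move=> xI; have tt : t1 <= t <= t2 by move: tI => /andP[? ?]; rewrite !ltW.
  have := smooth_on_continuous sh (AW' _ (eP t x tt xI)).
  exact: continuous_comp (@slice_r_continuous R t x).
have xcd x : r1 t <= x <= r2 t -> c < x < d.
  have [/r1P[_ /andP[cr1 _] _] /r2P[_ /andP[_ r2d] _] _] := sP t tI'.
  by move=> /andP[rx xr]; rewrite (lt_le_trans cr1)// (le_lt_trans xr).
have dH x : r1 t <= x <= r2 t -> is_derive x (1 : R)
    (sint (fun y => h (t, y)) c) (h (t, x)).
  by move=> /xcd xI; exact: is_derive_sint xI ch.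
have ch' x : r1 t <= x <= r2 t -> {for x, continuous (fun y => h (t, y))}.
  by move=> /xcd /andP[? ?]; apply: ch; rewrite !ltW.
have [x xI ->] := sint_mean r12 dH ch'.
move=> /eqP; rewrite mulf_eq0 subr_eq0 [_ == r1 t]gt_eqF// orbF.
by have [_ /negP] := inA t x tI' xI.
Unshelve. all: by end_near. Qed.

End Solution.
Lemma scalar_to_integral : scalar_invariant n p P Om J ->
  integral_invariant n p P Om (fun x => jdens x * J x).
Proof.
move=> inv u W sol t1 t2 r1 r2 tr dom t tI.
have [r12 _ _] := tr t tI.
have := is_derive_transported sol tr dom tI.
rewrite sint_eq0// => // r rI; have [Wr Omr] := dom t r tI rI.
have W'r : jet_preimage u W Om (t, r).
  by split=> //=; rewrite -(jet_fieldE u (solution_open sol) k Wr).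
rewrite (balance_invariant sol)//.
have /(scalar_invariantP n oP sp sJ) inv' := inv.
by rewrite (inv' u W sol)// mulr0.
Qed.

Lemma integral_to_scalar :
  integral_invariant n p P Om (fun x => jdens x * J x) ->
  scalar_invariant n p P Om J.
Proof.
move=> inv; apply/(scalar_invariantP n oP sp sJ) => u W sol z W'z.
apply: (material_eq0 sol) => // t1 t2 r1 r2 tr dom t tI.
have dom' s r : t1 < s < t2 -> r1 s <= r <= r2 s ->
    W (s, r) /\ Om (jet_of k u s r).
  move=> sI rI; have [Wr Omr] := dom s r sI rI.
  by split=> //; rewrite (jet_fieldE u (solution_open sol) k Wr).
(* The same derivative is given by the transport theorem and, by hypothesis, equal to 0. *)
have [_ <-] := is_derive_transported sol tr dom' tI.
by have [_] := inv u W sol t1 t2 r1 r2 tr dom' t tI.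
Qed.

End IntegralInvariants.

Theorem proposition3p1 (R : realType) (n : nat) (hn : (1 < n)%N)
    (P : set (R * R)) (p : R * R -> R) (hP : open P) (hp : smooth_on P p)
    (k : nat) (Om : set (jet R k)) (J : jet R k -> R)
    (hOm : open Om) (hJ : smooth_on Om J) :
  [<-> scalar_invariant n p P Om J;
       one_form_invariant n p P Om
         (fun x => jrad x ^+ n.-1 * jdens x * J x);
       vector_invariant n p P (Om `&` [set x | J x != 0])
         (fun x => jrad x ^- n.-1 / (jdens x * J x));
       integral_invariant n p P Om (fun x => jdens x * J x)].
Proof.
tfae.
- exact: scalar_to_one_form.
- exact: one_form_to_vector.
(* This link passes through scalar invariance, where the points with [J x = 0] are recovered. *)
- move=> vec; apply: scalar_to_integral => //.
  exact: vector_to_scalar vec.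
- exact: integral_to_scalar.
Qed.
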